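(* $\mathcal C^*$ is a countable $\mathbb Q$-subspace of $\mathcal S'$. Moreover, for every $\Phi\in\mathcal S^*$ there exists a sequence $(\Phi_n)$ in $\mathcal C^*$ converging pointwise to $\Phi$ with respect to the discrete topology on $\mathbb Q$, i.e., for every $\alpha\in\mathcal S$ one has $\Phi_n(\alpha)=\Phi(\alpha)$ for all sufficiently large $n$.
   Context: Let $\overline{\mathbb Q}$ be an algebraic closure of $\mathbb Q$, $A$ the ring of algebraic integers, $\mathcal S=\overline{\mathbb Q}^\times/A^\times$ (a $\mathbb Q$-vector space, written multiplicatively with scalar action $\alpha\mapsto\alpha^r$). $\mathcal S^*$ is the set of $\mathbb Q$-linear maps $\mathcal S\to\mathbb Q$. For a number field $K$ and non-Archimedean place $v$ of $K$, $p_v$ is the prime below $v$, $K_v$ the completion, $\|\cdot\|_v$ the extension to $K_v$ of the $p_v$-adic absolute value, and $|x|_v=\|x\|_v^{[K_v:\mathbb Q_{p_v}]/[K:\mathbb Q]}$. The norm on $\mathcal S$ is $\|\gamma\|_{\mathcal S}=\sum_v|\log|\gamma|_v|$ over non-Archimedean places of any number field $K\ni\gamma$; $\mathcal S'$ is the set of elements of $\mathcal S^*$ continuous for this norm and the usual absolute value on $\mathbb Q$. Let $\mathcal H_K$ be the image of $K^\times$ in $\mathcal S$, $\mathcal S_K=\{\alpha:\alpha^n\in\mathcal H_K\text{ for some }n\in\mathbb N\}$, $\|\alpha\|_v=\|\alpha^n\|_v^{1/n}$ when $\alpha^n\in\mathcal H_K$. Let $\mathcal J$ be the set of pairs $(K,v)$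 with $K$ a number field and $v$ a non-Archimedean place of $K$. A map $c:\mathcal J\to\mathbb Q$ is consistent if $c(K,v)=\sum_{w\mid v}c(L,w)$ for all number fields $K$, finite extensions $L/K$, non-Archimedean $v$ of $K$. For consistent $c$, $\Phi_c(\alpha)=\sum_v\frac{c(K,v)}{\log p_v}\log\|\alpha\|_v$ over non-Archimedean places of any $K$ with $\alpha\in\mathcal S_K$; every element of $\mathcal S^*$ is $\Phi_c$ for a unique consistent $c$. $G=\mathrm{Gal}(\overline{\mathbb Q}/\mathbb Q)$ acts on $\mathcal S$, and $\mathrm{Stab}_G(\Phi)=\{\sigma\in G:\Phi\circ\sigma=\Phi\}$; $\mathcal S^*_{\mathrm{fin}}=\{\Phi\in\mathcal S^*:[G:\mathrm{Stab}_G(\Phi)]<\infty\}$. A consistent map $c$ is supported on a set $\mathfrak P$ of primes if $c(K,v)=0$ whenever $v$ does not divide a prime in $\mathfrak P$; it (and $\Phi_c$) is compactly supported if it is supported on some finite $\mathfrak P$. $\mathcal S^*_{\mathrm{com}}$ is the set of compactly supported elements of $\mathcal S^*$, and $\mathcal C^*=\mathcal S^*_{\mathrm{fin}}\cap\mathcal S^*_{\mathrm{com}}$. *)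

(* Defs.v *)
From HB Require Import structures.
From mathcomp Require Import all_boot all_order all_algebra all_field.
From mathcomp Require Import classical_sets cardinality Rstruct.
From Stdlib Require Rpower ClassicalEpsilon.

Set Implicit Arguments.
Unset Strict Implicit.
Unset Printing Implicit Defensive.

Import Order.TTheory GRing.Theory Num.Theory.
Local Open Scope ring_scope.

Notation RR := Rdefinitions.R.
Definition rlog (x : RR) : RR := Rpower.ln x.

Definition choose_nat (P : nat -> Prop) : nat :=
  ClassicalEpsilon.epsilon (inhabits 0%N) P.

Definition is_subfield (K : pred algC) : Prop :=
  [/\ K 1,
      forall x y, K x -> K y -> K (x - y),
      forall x y, K x -> K y -> K (x * y) &
      forall x, K x -> K x^-1].

Definition rat_comb (q : seq rat) (s : seq algC) : algC :=
  \sum_(i < size s) ratr (nth 0 q i) * nth 0 s i.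

Definition is_Qbasis (K : pred algC) (s : seq algC) : Prop :=
  [/\ all K s,
      (forall x, K x -> exists q : seq rat, x = rat_comb q s) &
      (forall q : seq rat, size q = size s -> rat_comb q s = 0 ->
          forall i, (i < size s)%N -> nth 0 q i = 0)].

Definition number_field (K : pred algC) : Prop :=
  is_subfield K /\ exists s, is_Qbasis K s.

Definition degQ (K : pred algC) : nat :=
  choose_nat (fun n => exists s, is_Qbasis K s /\ size s = n).

(* Non-Archimedean places.  A non-Archimedean place v of K lying over *)
(* the prime p is represented by the absolute value ||.||_v on K that *)
(* extends the p-adic absolute value of Q (so ||p||_v = 1/p); it is   *)
(* set to 0 outside K so that the representation is canonical.        *)

Definition is_nonarch_abs (K : pred algC) (v : algC -> RR) (p : nat) : Prop :=
  [/\ forall x y, K x -> K y -> v (x * y) = v x * v y,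
      forall x y, K x -> K y -> v (x + y) <= Num.max (v x) (v y) &
      v p%:R = p%:R^-1].

Definition is_place_over (K : pred algC) (p : nat) (v : algC -> RR) : Prop :=
  [/\ prime p,
      forall x, ~~ K x -> v x = 0,
      forall x, 0 <= v x,
      forall x, K x -> (v x = 0 <-> x = 0) &
      is_nonarch_abs K v p].

Definition is_place (K : pred algC) (v : algC -> RR) : Prop :=
  exists p, is_place_over K p v.

Definition prime_below (K : pred algC) (v : algC -> RR) : nat :=
  choose_nat (fun p => is_place_over K p v).

Definition place_above (K : pred algC) (v : algC -> RR) (w : algC -> RR) : Prop :=
  forall x, K x -> w x = v x.

(* Local degree [K_v : Q_p] = e_v * f_v, with e_v the ramification index
   (index of the value group of v over that of Q) and f_v the residue
   degree (|O_v / m_v| = p ^ f_v). *)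
Definition is_ram_index (K : pred algC) (v : algC -> RR) (e : nat) : Prop :=
  (0 < e)%N /\
  exists pi, [/\ K pi, pi != 0, v pi ^+ e = (prime_below K v)%:R^-1 &
    forall x, K x -> x != 0 -> exists k : int, v x = v pi ^ k].

Definition is_res_degree (K : pred algC) (v : algC -> RR) (f : nat) : Prop :=
  exists s : seq algC,
  [/\ size s = (prime_below K v ^ f)%N,
      all K s,
      all (fun x => v x <= 1) s,
      (forall i j, (i < size s)%N -> (j < size s)%N -> i != j ->
          v (nth 0 s i - nth 0 s j) = 1) &
      (forall x, K x -> v x <= 1 -> exists2 i, (i < size s)%N &
          v (x - nth 0 s i) < 1)].

Definition local_degree (K : pred algC) (v : algC -> RR) : nat :=
  (choose_nat (is_ram_index K v) * choose_nat (is_res_degree K v))%N.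

(* The space S = Qbar^x / A^x.  An element of S is represented by a    *)
(* nonzero x : algC; x and x*u (u a unit of A) represent the same      *)
(* element.  alpha \in S_K iff alpha^n \in H_K for some n >= 1, i.e.   *)
(* x^n = y * u with y \in K^x and u \in A^x; then                      *)
(* ||alpha||_v = ||y||_v^(1/n).                                        *)

Definition Aunit (u : algC) : Prop := u \in Aint /\ u^-1 \in Aint /\ u != 0.

Definition in_SK (K : pred algC) (x : algC) (n : nat) (y : algC) : Prop :=
  [/\ (0 < n)%N, K y, y != 0 & exists u, Aunit u /\ x ^+ n = y * u].

Definition covers_support (K : pred algC) (y : algC) (vs : seq (algC -> RR)) : Prop :=
  [/\ List.NoDup vs,
      (forall v, List.In v vs -> is_place K v) &
      (forall v, is_place K v -> v y != 1 -> List.In v vs)].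

(* log ||alpha||_v, for alpha represented by x with x^n = y u, y in K *)
Definition log_vnorm (v : algC -> RR) (n : nat) (y : algC) : RR :=
  rlog (v y) / n%:R.

(* ||alpha||_S = sum_v | log |alpha|_v |,  log|alpha|_v = [K_v:Q_p]/[K:Q] log||alpha||_v.
   normS x r : r is the S-norm of the class of x (computed in any
   number field K with alpha in S_K). *)
Definition normS (x : algC) (r : RR) : Prop :=
  forall K n y vs, number_field K -> in_SK K x n y -> covers_support K y vs ->
    r = \sum_(v <- vs)
          `| (local_degree K v)%:R / (degQ K)%:R * log_vnorm v n y |.

(* S^* : Q-linear maps S -> Q.  As S is written multiplicatively, such a
   map is a function Phi on algC^x with Phi(xy) = Phi x + Phi y that
   vanishes on A^x (Q-homogeneity is automatic for additive maps into Q);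
   we normalize Phi 0 = 0 (0 does not represent an element of S). *)
Definition Sdual (Phi : algC -> rat) : Prop :=
  [/\ Phi 0 = 0,
      forall x y, x != 0 -> y != 0 -> Phi (x * y) = Phi x + Phi y &
      forall u, Aunit u -> Phi u = 0].

Definition Sprime (Phi : algC -> rat) : Prop :=
  Sdual Phi /\
  forall x0, x0 != 0 -> forall eps : RR, 0 < eps -> exists2 delta : RR, 0 < delta &
    forall x r, x != 0 -> normS (x / x0) r -> r < delta ->
      `| ratr (Phi x) - ratr (Phi x0) : RR | < eps.

(* consistent maps c : J -> Q (values of c outside J are irrelevant) *)
Definition consistent (c : pred algC -> (algC -> RR) -> rat) : Prop :=
  forall K L v, number_field K -> number_field L -> {subset K <= L} ->
    is_place K v ->
    exists ws : seq (algC -> RR),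
      [/\ List.NoDup ws,
          (forall w, List.In w ws <-> is_place L w /\ place_above K v w) &
          c K v = \sum_(w <- ws) c L w].

Definition is_Phi_c (c : pred algC -> (algC -> RR) -> rat) (Phi : algC -> rat) : Prop :=
  forall x K n y vs, x != 0 -> number_field K -> in_SK K x n y ->
    covers_support K y vs ->
    (ratr (Phi x) : RR) =
      \sum_(v <- vs) ratr (c K v) / rlog (prime_below K v)%:R * log_vnorm v n y.

Definition supported_on (c : pred algC -> (algC -> RR) -> rat) (P : seq nat) : Prop :=
  forall K v, number_field K -> is_place K v -> prime_below K v \notin P ->
    c K v = 0.

Definition compactly_supported (Phi : algC -> rat) : Prop :=
  exists c, [/\ consistent c, is_Phi_c c Phi & exists P, supported_on c P].

(* G = Gal(Qbar/Q): the ring endomorphisms of algC (all of which are   *)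
(* automorphisms fixing Q).                                            *)
Definition Gal := {rmorphism algC -> algC}.

Definition in_Stab (Phi : algC -> rat) (s : Gal) : Prop :=
  forall x, Phi (s x) = Phi x.

Definition finite_index_stab (Phi : algC -> rat) : Prop :=
  exists taus : seq Gal, forall s : Gal, exists tau,
    List.In tau taus /\ exists h : Gal, in_Stab Phi h /\ forall x, s x = h (tau x).

Definition Sdual_fin (Phi : algC -> rat) : Prop := Sdual Phi /\ finite_index_stab Phi.
Definition Sdual_com (Phi : algC -> rat) : Prop := Sdual Phi /\ compactly_supported Phi.

Definition Cstar : set (algC -> rat) := fun Phi => Sdual_fin Phi /\ Sdual_com Phi.

(* Main.v *)
(* A place of Qbar above p is encoded by lam p x = log_p |x|, which is
   rational-valued; it comes from a subring of algC that is maximal among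
   those not containing 1/p.  By weak approximation the places of a number
   field K above p are the restrictions of x |-> lam p (s x), s in G.

   Phi in S^* with finite-index stabilizer is fixed by every s fixing some th,
   so it is determined by its values on Q(th), through the norm to Q(th);
   compact support then makes it a finite Q-combination of the functionals

     atom p th t x = mean over s in G of [s th = t] * lam p (s x),

   and conversely each atom lies in C^*, with c(L, w) the mean of
   [s th = t] * [lam p o s induces w on L].  Countability follows, and so does
   the approximation property, which becomes finite-dimensional linear
   algebra: an element of norm 1 at every place is a unit.

   Continuity: computing in K = Q(z), |atom p th t z| is at most the sum over
   v | p of #{embeddings inducing v} / [K : Q] * |log_p |z|_v|, and this number
   of embeddings is at most the local degree e f by independence of characters. *)
Require Import Defs.
From HB Require Import structures.
From mathcomp Require Import all_boot all_order all_algebra all_field.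
From mathcomp Require Import classical_sets cardinality Rstruct.
From mathcomp Require Import boolp ring lra.
From Stdlib Require Permutation.
Import Order.TTheory GRing.Theory Num.Theory.
Local Open Scope ring_scope.

Set Implicit Arguments.
Unset Strict Implicit.
Unset Printing Implicit Defensive.

Local Notation Gal := Defs.Gal.
Local Notation QtoC := (ratr : rat -> algC).
Local Notation pQtoC := (map_poly QtoC).

(** * Conjugates and automorphisms of algC *)

Definition conjs (x : algC) : seq algC :=
  sval (closed_field_poly_normal (minCpoly x)).

Lemma minCpoly_conjs x : minCpoly x = \prod_(z <- conjs x) ('X - z%:P).
Proof.
rewrite /conjs; case: closed_field_poly_normal => r /= Dr.
by rewrite {1}Dr (monicP (minCpoly_monic x)) scale1r.
Qed.

Lemma mem_conjs x t : (t \in conjs x) = root (minCpoly x) t.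
Proof. by rewrite minCpoly_conjs root_prod_XsubC. Qed.

Lemma conjs_id x : x \in conjs x.
Proof. by rewrite mem_conjs root_minCpoly. Qed.

Lemma conjs_aut (s : Gal) x : s x \in conjs x.
Proof. by rewrite mem_conjs -(minCpoly_aut s) root_minCpoly. Qed.

Lemma minCpoly_irreducible x p :
  p \is monic -> (forall q, root (pQtoC q) x = (p %| q)) -> irreducible_poly p.
Proof.
move=> mon_p dv_p; have nz_p := monic_neq0 mon_p.
have px : root (pQtoC p) x by rewrite dv_p.
split=> [|q q_n1 q_dv_p].
  by rewrite -(size_map_poly QtoC); apply: root_size_gt1 px; rewrite map_poly_eq0.
have [r Dr] := dvdpP _ _ q_dv_p.
have /andP[nz_r nz_q] : (r != 0) && (q != 0) by rewrite -negb_or -mulf_eq0 -Dr.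
move: px; rewrite Dr rmorphM rootM !dv_p => /orP[/dvdp_leq|p_q]; last first.
  by rewrite -Dr /eqp q_dv_p.
move=> /(_ nz_r); rewrite Dr size_mul // => le_rq.
have := size_poly_gt0 q; rewrite nz_q; case: (size q) q_n1 le_rq => [|[|k]] // _.
by rewrite addnS /= addnS ltnNge leq_addr.
Qed.

Lemma conjs_uniq x : uniq (conjs x).
Proof.
rewrite -separable_prod_XsubC -minCpoly_conjs.
have [p [Dp mon_p] dv_p] := minCpolyP x.
have [p_gt1 irr_p] := minCpoly_irreducible mon_p dv_p.
rewrite Dp separable_map.
have nz_p' : p^`() != 0.
  apply/eqP => /(congr1 (fun q : {poly rat} => q`_(size p).-2)).
  rewrite coef_deriv coef0 -[(size p).-2.+1]/(size p).-2.+1 prednK; last first.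
    by case: (size p) p_gt1 => [|[]].
  rewrite -[_`_ _]/(lead_coef p) (monicP mon_p) => /eqP.
  by rewrite pnatr_eq0; case: (size p) p_gt1 => [|[]].
rewrite unlock; apply/negPn/negP => ncop.
have := irr_p _ ncop (dvdp_gcdl _ _) => /andP[_ /dvdp_trans].
move/(_ _ (dvdp_gcdr _ _))/(dvdp_leq nz_p').
by rewrite leqNgt lt_size_deriv // monic_neq0.
Qed.

Lemma conjs_size_gt0 x : (0 < size (conjs x))%N.
Proof. by case: (conjs x) (conjs_id x). Qed.

Lemma size_minCpoly_conjs x : size (minCpoly x) = (size (conjs x)).+1.
Proof. by rewrite minCpoly_conjs size_prod_XsubC. Qed.

Lemma perm_conjs_aut (s : Gal) x : perm_eq (map s (conjs x)) (conjs x).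
Proof.
have us: uniq (map s (conjs x)) by rewrite map_inj_uniq ?conjs_uniq //; apply: fmorph_inj.
have sub: {subset map s (conjs x) <= conjs x}.
  move=> _ /mapP[t tx ->]; rewrite mem_conjs.
  rewrite mem_conjs in tx; have [p [Dp _] _] := minCpolyP x.
  rewrite Dp -(eq_map_poly (fmorph_rat s)) map_poly_comp fmorph_root.
  by rewrite -Dp.
apply: uniq_perm => //; first exact: conjs_uniq.
by apply: (uniq_min_size us sub _).2; rewrite size_map.
Qed.

Lemma conj_autP x t : t \in conjs x -> exists s : Gal, s x = t.
Proof.
move=> tx.
have [Qs [QsC [rs Drs genQs]]] := num_field_exists (conjs x).
have [p [Dp mon_p] dv_p] := minCpolyP x.
have inAlg q : map_poly QsC (map_poly (in_alg Qs) q) = pQtoC q.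
  by rewrite -map_poly_comp; apply: eq_map_poly => b /=; rewrite alg_num_field fmorph_rat.
pose P := map_poly (in_alg Qs) p.
have DP: P = \prod_(z <- rs) ('X - z%:P).
  apply: (map_poly_inj QsC); rewrite inAlg -Dp minCpoly_conjs -Drs big_map.
  rewrite rmorph_prod; apply: eq_bigr => z _.
  by rewrite rmorphB /= map_polyX map_polyC.
have Pover: P \is a polyOver 1%VS.
  by apply/polyOverP=> i; rewrite coef_map /= rpredZ // mem1v.
have spl: splitting_field_axiom Qs.
  by exists P => //; exists rs => //; rewrite DP eqpxx.
pose spM := FieldExt_isSplittingField.Build rat Qs spl.
pose L : splittingFieldType rat := HB.pack Qs spM.
have : x \in map QsC rs by rewrite Drs conjs_id.
case/mapP=> x0 x0rs Dx; have : t \in map QsC rs by rewrite Drs.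
case/mapP=> t0 t0rs Dt.
have rt: root (minPoly (1%AS : {subfield L}) x0) t0.
  have [q /eqP Dq]: exists q : {poly rat},
      minPoly (1%AS : {subfield L}) x0 == map_poly (in_alg Qs) q.
    have mo := minPolyOver (1%AS : {subfield L}) x0.
    have ex (i : nat) : exists a : rat, (minPoly (1%AS : {subfield L}) x0)`_i = in_alg Qs a.
      by have /vlineP[a ->] := polyOverP mo i; exists a.
    pose a i := sval (sig_eqW (ex i)).
    exists (\poly_(i < size (minPoly (1%AS : {subfield L}) x0)) a i).
    apply/eqP/polyP=> i; rewrite coef_map coef_poly /a.
    case: sig_eqW => b /= Db; rewrite Db; case: ltnP => // ge_i.
    by move: Db; rewrite nth_default // => <-; rewrite scale0r.
  have: root (pQtoC q) x.
    by rewrite -inAlg Dx fmorph_root -Dq root_minPoly.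
  rewrite dv_p => /dvdpP[r Dr]; rewrite Dq Dr rmorphM rootM; apply/orP; right.
  have rP : root P t0 by rewrite DP root_prod_XsubC.
  exact: rP.
have nL: normalField (1%AS : {subfield L}) {:L}%AS by exact: normalFieldf.
have [g _ Dg] := normalField_root_minPoly (sub1v _) nL (memvf x0) rt.
have [nu Dnu] := extend_algC_subfield_aut QsC (g : {rmorphism L -> L}).
by exists nu; rewrite Dx -(Dnu x0) Dt; congr (QsC _); apply: Dg.
Qed.

Definition aut (x t : algC) : Gal :=
  ClassicalEpsilon.epsilon (inhabits (idfun : Gal)) (fun s => s x = t).

Lemma autE x t : t \in conjs x -> aut x t x = t.
Proof. by move=> /conj_autP; apply: ClassicalEpsilon.epsilon_spec. Qed.

Definition Qadjoin (th x : algC) : Prop := exists q : {poly rat}, x = (pQtoC q).[th].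

Lemma aut_horner (s : Gal) q x : s (pQtoC q).[x] = (pQtoC q).[s x].
Proof.
rewrite -horner_map -map_poly_comp.
by congr _.[_]; apply: eq_map_poly => a /=; rewrite fmorph_rat.
Qed.

Lemma aut_eq_Qadjoin (s t : Gal) th x : Qadjoin th x -> s th = t th -> s x = t x.
Proof. by case=> q -> e; rewrite !aut_horner e. Qed.

Lemma Qadjoin_id th : Qadjoin th th.
Proof. by exists 'X; rewrite map_polyX hornerX. Qed.

Lemma Qadjoin_rat th a : Qadjoin th (QtoC a).
Proof. by exists a%:P; rewrite map_polyC hornerC. Qed.

Lemma Qadjoin1 th : Qadjoin th 1.
Proof. by exists 1; rewrite rmorph1 hornerC. Qed.

Lemma QadjoinD th x y : Qadjoin th x -> Qadjoin th y -> Qadjoin th (x + y).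
Proof. by move=> [p ->] [q ->]; exists (p + q); rewrite rmorphD hornerD. Qed.

Lemma QadjoinB th x y : Qadjoin th x -> Qadjoin th y -> Qadjoin th (x - y).
Proof. by move=> [p ->] [q ->]; exists (p - q); rewrite rmorphB !hornerE. Qed.

Lemma QadjoinM th x y : Qadjoin th x -> Qadjoin th y -> Qadjoin th (x * y).
Proof. by move=> [p ->] [q ->]; exists (p * q); rewrite rmorphM hornerM. Qed.

Lemma QadjoinX th x n : Qadjoin th x -> Qadjoin th (x ^+ n).
Proof. by move=> [p ->]; exists (p ^+ n); rewrite rmorphXn horner_exp. Qed.

Lemma QadjoinV th x : Qadjoin th x -> Qadjoin th x^-1.
Proof.
case=> q Dx; have [->|nz_x] := eqVneq x 0.
  by rewrite invr0 -(rmorph0 QtoC); apply: Qadjoin_rat.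
have [p [_ mon_p] dv_p] := minCpolyP th.
have irr_p := minCpoly_irreducible mon_p dv_p.
have : coprimep p q.
  by rewrite irreducible_poly_coprime // -dv_p /root -Dx.
case/Bezout_eq1_coprimepP=> -[u v] /= Duv; exists v.
have /(congr1 (horner^~ th)) := congr1 pQtoC Duv.
rewrite rmorphD !rmorphM rmorph1 hornerD !hornerM hornerC -Dx.
have /rootP -> : root (pQtoC p) th by rewrite dv_p.
rewrite mulr0 add0r => Dv.
by apply: (mulIf nz_x); rewrite mulVf // Dv.
Qed.

Lemma Qadjoin_trans x y z : Qadjoin x y -> Qadjoin y z -> Qadjoin x z.
Proof. by move=> [p ->] [q ->]; exists (q \Po p); rewrite map_comp_poly horner_comp. Qed.

Definition primitive_elt (s : seq algC) : algC := s2val (algC_PET s).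

Lemma Qadjoin_primitive s x : x \in s -> Qadjoin (primitive_elt s) x.
Proof.
rewrite /primitive_elt; case: algC_PET => z _ /= [ps Dps]; rewrite {1}Dps.
by case/mapP=> p _ ->; exists p.
Qed.

Lemma fixed_Crat x : (forall s : Gal, s x = x) -> x \in Crat.
Proof.
move=> fx; have sub : {subset conjs x <= [:: x]}.
  by move=> t /conj_autP[s <-]; rewrite fx mem_head.
have /eqP sz1 : size (conjs x) == 1%N.
  rewrite eqn_leq conjs_size_gt0 andbT.
  exact: uniq_leq_size (conjs_uniq x) sub.
have [p [Dp _] _] := minCpolyP x.
have : minCpoly x = 'X - x%:P.
  rewrite minCpoly_conjs; case: (conjs x) sz1 (conjs_id x) => [|t []] // _.
  by rewrite inE => /eqP <-; rewrite big_seq1.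
rewrite Dp => /(congr1 (fun q : {poly algC} => q`_0)).
rewrite coef_map coefB coefX coefC /= sub0r => /(congr1 -%R); rewrite opprK => <-.
by rewrite rpredN Crat_rat.
Qed.

Lemma fixed_Qadjoin th y : (forall s : Gal, s th = th -> s y = y) -> Qadjoin th y.
Proof.
move=> fy; pose L t := \prod_(s <- conjs th | s != t) ((t - s)^-1 *: ('X - s%:P)).
pose r := \sum_(t <- conjs th) aut th t y *: L t.
have L1 t : (L t).[t] = 1.
  rewrite horner_prod big1 // => s ne_st.
  by rewrite hornerZ hornerXsubC mulVf // subr_eq0 eq_sym.
have L0 s t : s \in conjs th -> s != t -> (L t).[s] = 0.
  move=> sth st; rewrite horner_prod (big_rem s) //= st.
  by rewrite hornerZ hornerXsubC subrr mulr0 mul0r.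
have rth : r.[th] = y.
  rewrite horner_sum (bigD1_seq th) ?conjs_id ?conjs_uniq //=.
  rewrite hornerZ L1 mulr1 fy ?autE ?conjs_id //.
  rewrite big1_seq ?addr0 // => t /andP[ne_t _].
  by rewrite hornerZ L0 ?mulr0 ?conjs_id // eq_sym.
have fr (s : Gal) : map_poly s r = r.
  rewrite rmorph_sum -[RHS](perm_big _ (perm_conjs_aut s th)) big_map /=.
  apply: eq_big_seq => t tth; rewrite map_polyZ; congr (_ *: _).
    have st : s t \in conjs th by rewrite -(perm_mem (perm_conjs_aut s th)) map_f.
    have: algC_invaut (aut th (s t)) (s (aut th t y)) = y.
      rewrite -[RHS](fy ((algC_invaut (aut th (s t)) \o (s \o aut th t)) : Gal)) //=.
      by rewrite (autE tth) -[X in algC_invaut _ X](autE st) algC_autK.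
    by move/(congr1 (aut th (s t))); rewrite algC_invautK.
  rewrite rmorph_prod /L -[RHS](perm_big _ (perm_conjs_aut s th)) big_map /=.
  apply: eq_big => [u|u _]; first by rewrite (inj_eq (fmorph_inj s)).
  by rewrite map_polyZ rmorphB /= map_polyX map_polyC fmorphV rmorphB.
have /choice[a Da] i : exists a, r`_i = QtoC a.
  by apply/CratP/fixed_Crat => s; rewrite -{2}(fr s) coef_map.
exists (\poly_(i < size r) a i); rewrite -rth; congr _.[_].
apply/polyP=> i; rewrite coef_map coef_poly /=.
case: ltnP => // /(nth_default 0) ->; exact/esym/rmorph0.
Qed.

(** * Means over the Galois group *)

Definition determined {T} (F : Gal -> T) (th : algC) : Prop :=
  forall s t : Gal, s th = t th -> F s = F t.

(* The average of F over the Galois group, if F s depends only on s th. *)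
Definition mean (R : numFieldType) (th : algC) (F : Gal -> R) : R :=
  (\sum_(t <- conjs th) F (aut th t)) / (size (conjs th))%:R.

Lemma eq_mean (R : numFieldType) th (F G : Gal -> R) : F =1 G -> mean th F = mean th G.
Proof. by move=> FG; congr (_ / _); apply: eq_bigr => t _. Qed.

Lemma meanD (R : numFieldType) th (F G : Gal -> R) :
  mean th (fun s => F s + G s) = mean th F + mean th G.
Proof. by rewrite /mean big_split mulrDl. Qed.

Lemma meanZ (R : numFieldType) th q (F : Gal -> R) : mean th (fun s => q * F s) = q * mean th F.
Proof. by rewrite /mean -mulr_sumr mulrA. Qed.

Lemma mean0 (R : numFieldType) th : mean th (fun=> 0 : R) = 0.
Proof. by rewrite /mean big1 ?mul0r. Qed.

Lemma mean_sum (R : numFieldType) th (I : Type) (r : seq I) (F : I -> Gal -> R) :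
  mean th (fun s => \sum_(i <- r) F i s) = \sum_(i <- r) mean th (F i).
Proof. by rewrite /mean exchange_big /= mulr_suml. Qed.

Lemma ratr_mean (R : numFieldType) th (F : Gal -> rat) :
  ratr (mean th F) = mean th (fun s => ratr (F s)) :> R.
Proof. by rewrite /mean fmorph_div rmorph_nat rmorph_sum. Qed.

Lemma normr_mean_le (R : numFieldType) th (F : Gal -> R) :
  `|mean th F| <= mean th (fun s => `|F s|).
Proof.
rewrite /mean normrM [`|_^-1|]gtr0_norm ?invr_gt0 ?ltr0n ?conjs_size_gt0 //.
by rewrite ler_wpM2r ?invr_ge0 ?ler0n // ler_norm_sum.
Qed.

Lemma sum_conjs_Qadjoin (R : numFieldType) eta th (G : algC -> R) q : th = (pQtoC q).[eta] ->
  (\sum_(s <- conjs eta) G (pQtoC q).[s]) * (size (conjs th))%:R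
    = (size (conjs eta))%:R * \sum_(t <- conjs th) G t.
Proof.
move=> Dth; pose h s := (pQtoC q).[s].
pose k t := count (fun s => h s == t) (conjs eta).
have kE (G' : algC -> R) : \sum_(s <- conjs eta) G' (h s) = \sum_(t <- conjs th) (k t)%:R * G' t.
  transitivity (\sum_(s <- conjs eta) \sum_(t <- conjs th | t == h s) G' t).
    apply: eq_big_seq => s /conj_autP[u us]; rewrite -big_filter.
    rewrite filter_pred1_uniq ?big_seq1 ?conjs_uniq //.
    by rewrite /h -us -aut_horner -Dth conjs_aut.
  under eq_bigr do rewrite big_mkcond.
  rewrite exchange_big; apply: eq_bigr => t _; rewrite -big_mkcond /=.
  by under eq_bigl do rewrite eq_sym; rewrite big_const_seq iter_addr_0 -[_ *+ _]mulr_natl.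
have kc t : t \in conjs th -> k t = k th.
  case/conj_autP=> s <-.
  rewrite /k -(permP (perm_conjs_aut s eta)) count_map; apply: eq_count => u /=.
  by rewrite /h -aut_horner (inj_eq (fmorph_inj s)).
have kS (G' : algC -> R) : \sum_(s <- conjs eta) G' (h s) = (k th)%:R * \sum_(t <- conjs th) G' t.
  by rewrite kE mulr_sumr; apply: eq_big_seq => t /kc ->.
have := kS (fun=> 1); rewrite /=.
rewrite !big_const_seq !iter_addr_0 !count_predT => ->.
by rewrite (kS G) mulrAC.
Qed.

Lemma mean_Qadjoin (R : numFieldType) eta th (F : Gal -> R) : Qadjoin eta th -> determined F th ->
  mean eta F = mean th F.
Proof.
case=> q Dth dF; have:= sum_conjs_Qadjoin (fun t => F (aut th t)) Dth.
have -> : \sum_(s <- conjs eta) F (aut th (pQtoC q).[s]) = \sum_(s <- conjs eta) F (aut eta s).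
  apply: eq_big_seq => s sth; apply: dF; rewrite autE.
    by rewrite Dth aut_horner autE.
  by rewrite -(autE sth) -aut_horner -Dth conjs_aut.
have nz x : (size (conjs x))%:R != 0 :> R by rewrite pnatr_eq0 -lt0n conjs_size_gt0.
move=> e; apply: (mulIf (nz th)); apply: (mulIf (nz eta)).
by rewrite /mean mulrAC divfK // e divfK // mulrC.
Qed.

Lemma mean_indep (R : numFieldType) eta th (F : Gal -> R) : determined F eta -> determined F th ->
  mean eta F = mean th F.
Proof.
move=> de dt; have pe : Qadjoin (primitive_elt [:: eta; th]) eta.
  by apply: Qadjoin_primitive; rewrite !inE eqxx.
have pt : Qadjoin (primitive_elt [:: eta; th]) th.
  by apply: Qadjoin_primitive; rewrite !inE eqxx orbT.
by rewrite -(mean_Qadjoin pe) // (mean_Qadjoin pt).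
Qed.

Lemma mean_comp (R : numFieldType) (u : Gal) th (F : Gal -> R) : determined F th ->
  mean (u th) (fun s : Gal => F (s \o u)) = mean th F.
Proof.
move=> dF; have cu : conjs (u th) = conjs th by rewrite /conjs minCpoly_aut.
rewrite /mean cu; congr (_ / _); apply: eq_big_seq => t tth; apply: dF => /=.
by rewrite !autE // cu.
Qed.

Lemma size_conjs_Qadjoin eta th : Qadjoin eta th ->
  (size (conjs th) <= size (conjs eta))%N.
Proof.
case=> q Dth; rewrite -(size_map (fun s => (pQtoC q).[s]) (conjs eta)).
apply: uniq_leq_size (conjs_uniq th) _ => t /conj_autP[s <-].
by rewrite Dth aut_horner map_f // conjs_aut.
Qed.

(** * Valuation rings of algC *)

Definition is_subring (A : set algC) : Prop :=
  [/\ A 1, forall x y, A x -> A y -> A (x - y) & forall x y, A x -> A y -> A (x * y)].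

Section Subring.
Variables (A : set algC) (sA : is_subring A).

Lemma subring1 : A 1. Proof. by case: sA. Qed.
Lemma subringB x y : A x -> A y -> A (x - y). Proof. by case: sA => _ + _; apply. Qed.
Lemma subringM x y : A x -> A y -> A (x * y). Proof. by case: sA => _ _; apply. Qed.
Lemma subring0 : A 0. Proof. by rewrite -(subrr 1); apply: subringB; apply: subring1. Qed.
Lemma subringN x : A x -> A (- x).
Proof. by move=> Ax; rewrite -sub0r; apply: subringB => //; apply: subring0. Qed.
Lemma subringD x y : A x -> A y -> A (x + y).
Proof. by move=> Ax Ay; rewrite -[y]opprK; apply: subringB => //; apply: subringN. Qed.
Lemma subringX x n : A x -> A (x ^+ n).
Proof.
move=> Ax; elim: n => [|n IH]; first by rewrite expr0; apply: subring1.
by rewrite exprS; apply: subringM.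
Qed.
Lemma subring_sum (I : Type) (r : seq I) (P : pred I) (F : I -> algC) :
  (forall i, P i -> A (F i)) -> A (\sum_(i <- r | P i) F i).
Proof. by move=> AF; apply: (big_ind A) => //; [apply: subring0 | apply: subringD]. Qed.
Lemma subring_nat n : A n%:R.
Proof.
elim: n => [|n IH]; first exact: subring0.
by rewrite -natr1; apply: subringD => //; apply: subring1.
Qed.

Definition adjoin (z : algC) : set algC :=
  [set x | exists2 f : {poly algC}, (forall i, A f`_i) & x = f.[z]].

Lemma adjoin_subring z : is_subring (adjoin z).
Proof.
split.
- exists 1; last by rewrite hornerC.
  by move=> i; rewrite coef1; case: eqP => _; [apply: subring1|apply: subring0].
- move=> _ _ [f Af ->] [g Ag ->]; exists (f - g); last by rewrite hornerD hornerN.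
  by move=> i; rewrite coefB; apply: subringB.
- move=> _ _ [f Af ->] [g Ag ->]; exists (f * g); last by rewrite hornerM.
  by move=> i; rewrite coefM; apply: subring_sum => j _; apply: subringM.
Qed.

Lemma adjoin_id z : adjoin z z.
Proof.
exists 'X; last by rewrite hornerX.
by move=> i; rewrite coefX; case: eqP => _; [apply: subring1|apply: subring0].
Qed.

Lemma sub_adjoin z : (A `<=` adjoin z)%classic.
Proof.
move=> x Ax; exists x%:P; last by rewrite hornerC.
by move=> i; rewrite coefC; case: eqP => // _; apply: subring0.
Qed.

End Subring.

Lemma horner_unbounded (f : {poly algC}) n x : (size f <= n)%N ->
  f.[x] = \sum_(i < n) f`_i * x ^+ i.
Proof.
move=> le_n; rewrite (horner_coef_wide x (n := n)) //.
Qed.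

Definition valuation_ring (V : set algC) : Prop :=
  is_subring V /\ forall x, x != 0 -> V x \/ V x^-1.

Section Maximal.
Variables (p : algC) (nz_p : p != 0) (A : set algC) (sA : is_subring A).
Hypotheses (Ap : A p) (pV : ~ A p^-1).
Hypothesis maxA : forall z, ~ A z -> adjoin A z p^-1.

Lemma maximal_unit b : A b -> A (1 - p * b)^-1.
Proof.
move=> Ab; set w := 1 - p * b; apply: contrapT => /maxA[f Af Df].
have nz_w : w != 0.
  rewrite subr_eq0; apply/eqP => pb; apply: pV.
  by have -> : p^-1 = b by apply: (mulfI nz_p); rewrite divff.
have [b' Ab' Db'] : exists2 b', A b' & w ^+ size f = 1 - p * b'.
  elim: (size f) => [|k [b' Ab' Db']].
    by exists 0; [apply: subring0 | rewrite expr0 mulr0 subr0].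
  exists (b + b' - p * b * b').
    by do ?[apply: subringM|apply: subringB|apply: subringD].
  by rewrite exprS Db' /w mulrBl mul1r !mulrBr mulrDr mulr1 !opprB !mulrA; ring.
pose a := \sum_(i < size f) f`_i * w ^+ (size f - i).
have Aw : A w by apply: subringB => //; [apply: subring1|apply: subringM].
have Aa : A a by apply: subring_sum => // i _; apply: subringM => //; apply: subringX.
have Da : p^-1 * w ^+ size f = a.
  rewrite Df horner_coef mulr_suml; apply: eq_bigr => i _.
  rewrite -mulrA; congr (_ * _); rewrite exprVn expfB_cond ?(negPf nz_w) //.
    by rewrite mulrC.
  by rewrite add0n ltnW.
apply: pV; have -> : p^-1 = a + b'; last exact: subringD.
by rewrite -Da Db' mulrBr mulr1 mulKf // subrK.
Qed.

Lemma maximal_valuation_ring : valuation_ring A.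
Proof.
split=> // u nz_u; apply: contrapT => /not_orP[/maxA[f Af Df] /maxA[g Ag Dg]].
have [n] := ubnP (size f + size g).
elim: n u nz_u f Af Df g Ag Dg => // n IHn u nz_u f Af Df g Ag Dg.
wlog le_gf : u nz_u f g Af Ag Df Dg / (size g <= size f)%N.
  move=> W; have [|/ltnW le_fg] := leqP (size g) (size f); first exact: (W u).
  rewrite addnC; apply: (W u^-1) => //; first by rewrite invr_eq0.
  by rewrite invrK.
case Dm: (size f) le_gf => [|m] le_g.
  move: Df (nz_p); rewrite -invr_eq0 => ->; move/eqP: Dm.
  by rewrite size_poly_eq0 => /eqP ->; rewrite horner0 eqxx.
rewrite addSn ltnS => lt_n.
pose c := (1 - p * g`_0)^-1.
have Ac : A c by apply: maximal_unit.
have nz_c : 1 - p * g`_0 != 0.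
  rewrite subr_eq0; apply/eqP => pb; apply: pV.
  by have -> : p^-1 = g`_0 by apply: (mulfI nz_p); rewrite divff.
pose f' := \poly_(i < m) (f`_i + f`_m * p * c * g`_(m - i)).
apply: (IHn u nz_u f' _ _ g) => //.
- move=> i; rewrite coef_poly; case: ifP => _; last exact: subring0.
  apply: subringD => //; do !apply: subringM => //.
- rewrite horner_poly Df (horner_unbounded _ (_ : (size f <= m.+1)%N)) ?Dm //.
  rewrite big_ord_recr /=; under [RHS]eq_bigr do rewrite mulrDl.
  rewrite big_split /=; congr (_ + _).
  under eq_bigr do rewrite -!mulrA.
  rewrite -!mulr_sumr; congr (_ * _).
  have : u ^+ m = p * \sum_(i < m.+1) g`_(m - i) * u ^+ i.
    rewrite (reindex_inj rev_ord_inj) /=.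
    rewrite -[LHS](mulVKf nz_p) Dg (horner_unbounded _ le_g) mulr_suml.
    congr (_ * _); apply: eq_bigr => i _; rewrite subSS subKn; last by rewrite -ltnS.
    rewrite -mulrA; congr (_ * _).
    by rewrite exprVn expfB_cond ?(negPf nz_u) 1?mulrC // add0n -ltnS.
  rewrite big_ord_recr /= subnn mulrDr => E.
  apply: (mulfI nz_c); rewrite mulrBl mul1r {1}E /c; field; exact: nz_c.
- by apply: leq_ltn_trans lt_n; rewrite leq_add2r size_poly.
Qed.
End Maximal.

Lemma exists_valuation_ring (p : nat) : prime p ->
  exists V : set algC, valuation_ring V /\ ~ V p%:R^-1.
Proof.
move=> pr_p; pose good A := is_subring A /\ ~ A p%:R^-1.
have nz_p : p%:R != 0 :> algC by rewrite pnatr_eq0 -lt0n prime_gt0.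
have goodZ : good [set x | x \in Num.int]%classic.
  split; first by split=> *; rewrite /= ?rpred1 ?rpredB ?rpredM.
  move=> /= pZ; have := @natr_int algC p; rewrite -[in X in X -> _](invrK p%:R) => piZ.
  have := norm_intr_ge1 pZ; rewrite invr_eq0 => /(_ nz_p).
  rewrite ger0_norm ?invr_ge0 ?ler0n // invf_ge1 ?ltr0n ?prime_gt0 //.
  by rewrite lern1 leqNgt prime_gt1.
have [F FP Ftot|A [PA maxA]] :=
    @Zorn_bigcup algC (fun A => forall x, A x -> good A).
  have goodF X x : F X -> X x -> good X by move=> FX Xx; apply: FP Xx.
  have common X Y x y : F X -> F Y -> X x -> Y y -> exists2 Z, F Z & Z x /\ Z y.
    move=> FX FY Xx Yy; have [XY|YX] := Ftot X Y FX FY.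
      by exists Y => //; split=> //; apply: XY.
    by exists X => //; split=> //; apply: YX.
  move=> x [X FX Xx]; have [sX _] := goodF X x FX Xx; split; last first.
    by case=> Y FY Yp; have [_] := goodF Y _ FY Yp; apply.
  split=> [|u v [Y FY Yu] [Z FZ Zv]|u v [Y FY Yu] [Z FZ Zv]].
  - by exists X => //; apply: subring1.
  - have [W FW [Wu Wv]] := common _ _ _ _ FY FZ Yu Zv.
    by exists W => //; have [sW _] := goodF W u FW Wu; apply: subringB.
  - have [W FW [Wu Wv]] := common _ _ _ _ FY FZ Yu Zv.
    by exists W => //; have [sW _] := goodF W u FW Wu; apply: subringM.
have [x Ax] : exists x, A x.
  apply: contrapT => /forallNP A0; apply: (maxA [set x | x \in Num.int]%classic) => //.
  split; first by move=> x /A0.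
  by move=> /(_ 0); apply: contra_not (A0 0) => /(_ _); apply; rewrite /= rpred0.
have [sA pA] := PA x Ax; exists A; split=> //.
apply: (maximal_valuation_ring nz_p) => // [|z Az].
  exact: subring_nat.
apply: contrapT => zp; apply: (maxA (adjoin A z)).
  split; first exact: sub_adjoin.
  by move=> /(_ z (adjoin_id sA z)).
by move=> y _; split=> //; apply: adjoin_subring.
Qed.

Section ValuationRing.
Variables (V : set algC) (vV : valuation_ring V).
Let sV : is_subring V := vV.1.

Lemma valuation_ring_total x : x != 0 -> V x \/ V x^-1. Proof. exact: vV.2. Qed.

Definition vassoc (x y : algC) : Prop := [/\ x != 0, y != 0, V (x / y) & V (y / x)].

Lemma vassoc_refl x : x != 0 -> vassoc x x.
Proof. by move=> nz_x; split=> //; rewrite divff //; apply: subring1. Qed.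

Lemma vassoc_sym x y : vassoc x y -> vassoc y x. Proof. by case. Qed.

Lemma vassoc_trans y x z : vassoc x y -> vassoc y z -> vassoc x z.
Proof.
move=> [nx ny xy yx] [_ nz yz zy]; split=> //.
  by rewrite -(mulfVK ny x) -[X in V X]mulrA; apply: subringM.
by rewrite -(mulfVK ny z) -[X in V X]mulrA; apply: subringM.
Qed.

Lemma vassocM x y z t : vassoc x y -> vassoc z t -> vassoc (x * z) (y * t).
Proof.
move=> [nx ny xy yx] [nz nt zt tz].
by split; rewrite ?mulf_neq0 // -mulf_div; apply: subringM.
Qed.

Lemma vassocV x y : vassoc x y -> vassoc x^-1 y^-1.
Proof. by move=> [nx ny xy yx]; split; rewrite ?invr_eq0 // invrK mulrC. Qed.

Lemma vassocX x y n : vassoc x y -> vassoc (x ^+ n) (y ^+ n).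
Proof.
move=> xy; elim: n => [|n IH]; first by rewrite !expr0; apply/vassoc_refl/oner_neq0.
by rewrite !exprS; apply: vassocM.
Qed.

Lemma vassoc_add x y : x != 0 -> y != 0 -> ~ vassoc x y ->
  vassoc (x + y) x \/ vassoc (x + y) y.
Proof.
wlog Vxy : x y / V (x / y).
  move=> W nx ny xy; have nxy : x / y != 0 by rewrite mulf_neq0 ?invr_eq0.
  have [Vxy|] := valuation_ring_total nxy; first exact: W.
  rewrite invf_div addrC => Vyx.
  by have [//|//|/vassoc_sym//||] := W _ _ Vyx; [right|left].
move=> nx ny nxy; have nVyx : ~ V (y / x) by move=> Vyx; apply: nxy.
right; set t := x / y in Vxy; have nt : t != 0 by rewrite mulf_neq0 ?invr_eq0.
have nVt : ~ V t^-1 by rewrite invf_div.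
have Vt1 : V (1 + t) by apply: subringD => //; apply: subring1.
have nt1 : 1 + t != 0.
  apply/eqP => t1; apply: nVt; have -> : t = -1 by apply/eqP; rewrite -addr_eq0 addrC t1.
  by rewrite invrN invr1; apply: subringN => //; apply: subring1.
have Dxy : x + y = y * (1 + t) by rewrite /t; field.
have nD : x + y != 0 by rewrite Dxy mulf_neq0.
split=> //; first by rewrite Dxy mulrC mulKf.
have -> : y / (x + y) = (1 + t)^-1 by rewrite Dxy invfM mulrA divff // mul1r.
have ntt : t / (1 + t) != 0 by rewrite mulf_neq0 ?invr_eq0.
have [Vtt|] := valuation_ring_total ntt.
  have -> : (1 + t)^-1 = 1 - t / (1 + t).
    by apply: (mulIf nt1); rewrite mulVf // mulrBl mul1r mulfVK // addrK.
  by apply: subringB => //; apply: subring1.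
rewrite invf_div mulrDl mul1r divff // => Vt; case: nVt.
by rewrite -[t^-1](addrK 1); apply: subringB => //; apply: subring1.
Qed.

Lemma vanishing_sum_vassoc (n : nat) (y : nat -> algC) (P : pred nat) :
  (forall i, P i -> y i != 0) -> \sum_(i < n | P i) y i = 0 ->
  (exists2 i, (i < n)%N & P i) ->
  exists i j, [/\ (i < j)%N, (j < n)%N, P i, P j & vassoc (y i) (y j)].
Proof.
move=> nzy sum0 exi; apply: contrapT => nex.
suff: forall m, (m <= n)%N -> (exists2 i, (i < m)%N & P i) ->
    exists2 i, (i < m)%N && P i & vassoc (\sum_(i < m | P i) y i) (y i).
  by move=> /(_ n (leqnn n) exi)[i _ []]; rewrite sum0 eqxx.
elim=> [|m IH] lt_m [i]; first by [].
rewrite ltnS => le_im Pi; rewrite big_mkcond big_ord_recr -big_mkcond /=.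
have [|no] := pselect (exists2 i, (i < m)%N & P i); last first.
  rewrite big_pred0 => [|j]; last first.
    by apply/negbTE/negP => Pj; apply: no; exists j.
  have im : i = m.
    by apply/eqP; rewrite eqn_leq le_im leqNgt; apply/negP => im; apply: no; exists i.
  by exists m; rewrite ?ltnSn -?im ?Pi // add0r; apply/vassoc_refl/nzy.
move=> /(IH (ltnW lt_m))[j /andP[jm Pj] Sj].
case: (boolP (P m)) => Pm; last first.
  by exists j; rewrite ?Pj ?ltnS 1?ltnW // addr0.
have nS : ~ vassoc (\sum_(i < m | P i) y i) (y m).
  move=> aS; apply: nex; exists j, m; split=> //.
  exact: vassoc_trans (vassoc_sym Sj) aS.
have nzS : \sum_(i < m | P i) y i != 0 by case: Sj.
have [aS|aS] := vassoc_add nzS (nzy _ Pm) nS.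
  by exists j; rewrite ?Pj ?ltnS 1?ltnW //; apply: vassoc_trans aS Sj.
by exists m => //; rewrite ltnSn.
Qed.
End ValuationRing.

(* lam x stands for log_p |x| at a place above p, so that |p| = 1/p. *)
Definition is_logval (p : nat) (lam : algC -> rat) : Prop :=
  [/\ lam 0 = 0,
      forall x y, x != 0 -> y != 0 -> lam (x * y) = lam x + lam y,
      forall x y, x != 0 -> y != 0 -> x + y != 0 -> lam (x + y) <= Num.max (lam x) (lam y),
      lam p%:R = -1 &
      forall x, x != 0 -> exists2 N, (0 < N <= size (conjs x))%N & N%:R * lam x \in Num.int].

Lemma vassoc_ratr (p : nat) (V : set algC) (a : rat) : prime p ->
  valuation_ring V -> ~ V p%:R^-1 -> a != 0 -> exists k : int, vassoc V (QtoC a) (p%:R ^ k).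
Proof.
move=> pr_p vV pV nz_a; have sV := vV.1.
have nz_p : p%:R != 0 :> algC by rewrite pnatr_eq0 -lt0n prime_gt0.
have cop m : coprime p m -> vassoc V m%:R 1.
  move=> pm; have m_gt0 : (0 < m)%N.
    by case: m pm => //; rewrite /coprime gcdn0 => /eqP p1; rewrite p1 in pr_p.
  have nz_m : m%:R != 0 :> algC by rewrite pnatr_eq0 -lt0n.
  split; rewrite ?oner_neq0 ?divr1 ?div1r //; first exact: subring_nat.
  have [u v Duv _] := egcdnP p m_gt0; rewrite gcdnC (eqP pm) in Duv.
  have {}Duv : u%:R * m%:R = v%:R * p%:R + 1 :> algC by rewrite -!natrM natr1 Duv addn1.
  have nz_pm : p%:R / m%:R != 0 :> algC by rewrite mulf_neq0 ?invr_eq0.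
  have [Vpm|] := vV.2 _ nz_pm.
    have -> : m%:R^-1 = u%:R - v%:R * (p%:R / m%:R) :> algC.
      by apply: (mulIf nz_m); rewrite mulVf // mulrBl Duv -!mulrA mulVf // mulr1 addrC addKr.
    by apply: subringB => //; [|apply: subringM => //]; apply: subring_nat.
  rewrite invf_div => Vmp; case: pV.
  have -> : p%:R^-1 = u%:R * (m%:R / p%:R) - v%:R :> algC.
    by rewrite mulrA Duv mulrDl mulfK // mul1r addrAC subrr add0r.
  by apply: subringB => //; [apply: subringM => //|]; apply: subring_nat.
have natP n : (0 < n)%N -> exists k : int, vassoc V n%:R (p%:R ^ k).
  move=> n_gt0; have [m pm {1}->] := pfactor_coprime pr_p n_gt0.
  exists (logn p n)%:Z; rewrite natrM natrX -[X in vassoc _ _ X]mul1r.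
  apply: vassocM => //; first exact: cop.
  by apply: vassoc_refl => //; rewrite expf_neq0.
have [k kP] : exists k : int, vassoc V (numq a)%:~R (p%:R ^ k).
  have [|k [n1 n2 V1 V2]] := natP `|numq a|%N; first by rewrite absz_gt0 numq_eq0.
  exists k; case: (numq a) n1 V1 V2 => m n1 V1 V2; first by split.
  rewrite NegzE rmorphN /=; split; rewrite ?oppr_eq0 //.
    by rewrite mulNr; apply: subringN.
  by rewrite invrN mulrN; apply: subringN.
have [l lP] : exists k : int, vassoc V (denq a)%:~R (p%:R ^ k).
  have [|l lP] := natP `|denq a|%N; first by rewrite absz_gt0 denq_eq0.
  by exists l; rewrite -[denq a]gez0_abs ?denq_ge0.
exists (k - l); rewrite /ratr expfzDr // -invr_expz.
by apply: vassocM => //; apply: vassocV.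
Qed.

Lemma exists_logval (p : nat) : prime p -> exists lam, is_logval p lam.
Proof.
move=> pr_p; have [V [vV pV]] := exists_valuation_ring pr_p; have sV := vV.1.
have nz_p : p%:R != 0 :> algC by rewrite pnatr_eq0 -lt0n prime_gt0.
have Vpz (k : int) : V (p%:R ^ k) -> 0 <= k.
  case: k => // n; rewrite NegzE -exprnN => Vp; case: pV.
  have -> : p%:R^-1 = p%:R ^+ n * (p%:R ^- n.+1) :> algC.
    by rewrite exprS invfM [_^-1 * _]mulrC mulrA divff ?mul1r ?expf_neq0.
  by apply: subringM => //; rewrite -natrX; apply: subring_nat.
have uniq_k (x : algC) (k l : int) : vassoc V x (p%:R ^ k) -> vassoc V x (p%:R ^ l) -> k = l.
  move=> /vassoc_sym/vassoc_trans E /E{E}-/(_ vV)[_ _].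
  rewrite !invr_expz -!expfzDr // => /Vpz; rewrite subr_ge0 => lk /Vpz.
  by rewrite subr_ge0 => kl; apply/eqP; rewrite eq_le kl lk.
have exNk x : exists Nk : nat * int, x != 0 ->
    (0 < Nk.1 <= size (conjs x))%N /\ vassoc V (x ^+ Nk.1) (p%:R ^ Nk.2).
  have [->|nz_x] := eqVneq x 0; first by exists (0, 0).
  have [q [Dq mon_q] dv_q] := minCpolyP x.
  have Dn : size q = (size (conjs x)).+1 by rewrite -size_minCpoly_conjs Dq size_map_poly.
  have [|||i [j [ij jn nqi nqj aij]]] :=
      @vanishing_sum_vassoc V vV (size q) (fun i => QtoC q`_i * x ^+ i) (fun i => q`_i != 0).
  - by move=> i nqi; rewrite mulf_neq0 ?fmorph_eq0 ?expf_neq0.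
  - have /rootP := root_minCpoly x; rewrite Dq horner_coef size_map_poly.
    apply: etrans; rewrite big_mkcond; apply: eq_bigr => i _; rewrite coef_map.
    by case: eqP => //= ->; rewrite rmorph0 mul0r.
  - exists (size q).-1; first by rewrite prednK ?Dn.
    by rewrite -[_`_ _]/(lead_coef q) (monicP mon_q) oner_neq0.
  have nzr : q`_i / q`_j != 0 by rewrite mulf_neq0 ?invr_eq0.
  have [k kP] := vassoc_ratr pr_p vV pV nzr.
  exists ((j - i)%N, k) => _ /=.
  rewrite subn_gt0 ij /= (leq_trans (leq_subr _ _)); last by rewrite -ltnS -Dn.
  split=> //; apply: (vassoc_trans vV _ kP).
  have := vassocM vV (vassoc_sym aij) (vassoc_refl vV (_ : (QtoC q`_j * x ^+ i)^-1 != 0)).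
  rewrite invr_eq0 mulf_neq0 ?fmorph_eq0 ?expf_neq0 // => /(_ isT).
  rewrite -(mulf_div (QtoC q`_j)) -(mulf_div (QtoC q`_i)).
  rewrite (divff (_ : x ^+ i != 0)) ?expf_neq0 // divff ?fmorph_eq0 // mul1r mulr1 fmorph_div.
  by rewrite expfB_cond ?(negPf nz_x) ?add0n // ltnW.
have /choice[Nk NkP] := exNk.
pose lam x : rat := if x == 0 then 0 else - (Nk x).2%:~R / (Nk x).1%:R.
have lamE x N k : (0 < N)%N -> vassoc V (x ^+ N) (p%:R ^ k) -> lam x = - k%:~R / N%:R.
  move=> N_gt0 aN; have nz_x : x != 0.
    by case: aN => + _ _ _; rewrite expf_eq0 N_gt0.
  rewrite /lam (negPf nz_x); have [/andP[M_gt0 _] aM] := NkP x nz_x.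
  have := vassocX vV N aM; have := vassocX vV (Nk x).1 aN.
  rewrite -!exprM mulnC ![(_ ^ _) ^+ _]exprnP !exprz_exp => aNk /(uniq_k _ _ _ aNk) e.
  have nzN : N%:R != 0 :> rat by rewrite pnatr_eq0 -lt0n.
  have nzM : (Nk x).1%:R != 0 :> rat by rewrite pnatr_eq0 -lt0n.
  rewrite !mulNr; congr (- _); apply/eqP; rewrite eqr_div //.
  by rewrite !pmulrn -!intrM e.
have lam_le0 x : x != 0 -> (lam x <= 0) <-> V x.
  move=> nz_x; have [/andP[M_gt0 _] aM] := NkP x nz_x.
  rewrite /lam (negPf nz_x) mulNr oppr_le0 pmulr_lge0 ?invr_gt0 ?ltr0n // ler0z.
  case: aM => nzxM nzpk V1 V2; split=> [k_ge0|Vx]; last first.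
    apply: Vpz; rewrite -(mulfVK nzxM (p%:R ^ _)); apply: subringM => //.
    exact: subringX.
  have VxN : V (x ^+ (Nk x).1).
    rewrite -(mulfVK nzpk (x ^+ _)); apply: subringM => //.
    by case: ((Nk x).2) k_ge0 => // n _; rewrite -exprnP -natrX; apply: subring_nat.
  have [//|Vxi] := vV.2 x nz_x.
  have -> : x = x ^+ (Nk x).1 * x^-1 ^+ (Nk x).1.-1.
    by case: (Nk x).1 M_gt0 => // m _; rewrite exprS -mulrA -exprMn divff // expr1n mulr1.
  by apply: subringM => //; apply: subringX.
have lamM x y : x != 0 -> y != 0 -> lam (x * y) = lam x + lam y.
  move=> nz_x nz_y.
  have [/andP[N_gt0 _] aN] := NkP x nz_x; have [/andP[M_gt0 _] aM] := NkP y nz_y.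
  have := vassocM vV (vassocX vV (Nk y).1 aN) (vassocX vV (Nk x).1 aM).
  rewrite -!exprM ![(_ ^ _) ^+ _]exprnP !exprz_exp -expfzDr // [((Nk y).1 * _)%N]mulnC -exprMn.
  move/lamE => ->; last by rewrite muln_gt0 N_gt0.
  rewrite /lam (negPf nz_x) (negPf nz_y) natrM rmorphD !rmorphM /=.
  have nzN : (Nk x).1%:R != 0 :> rat by rewrite pnatr_eq0 -lt0n.
  have nzM : (Nk y).1%:R != 0 :> rat by rewrite pnatr_eq0 -lt0n.
  by field; rewrite ?nzN ?nzM.
exists lam; split.
- by rewrite /lam eqxx.
- exact: lamM.
- have lamD x y : x != 0 -> y != 0 -> x + y != 0 -> lam x <= lam y -> lam (x + y) <= lam y.
    move=> nz_x nz_y nz_xy xy.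
    have nz_d : x / y != 0 by rewrite mulf_neq0 ?invr_eq0.
    have Dx : lam x = lam (x / y) + lam y by rewrite -lamM // mulfVK.
    have Dxy : x + y = (x / y + 1) * y by rewrite mulrDl mul1r mulfVK.
    have nz1 : x / y + 1 != 0 by move: nz_xy; rewrite Dxy mulf_eq0 => /norP[].
    rewrite Dxy lamM // gerDr; apply/lam_le0 => //.
    apply: subringD => //; last exact: subring1.
    by apply/lam_le0 => //; rewrite -(gerDr (lam y)) -Dx.
  move=> x y nz_x nz_y nz_xy; have [xy|/ltW yx] := leP (lam x) (lam y); first exact: lamD.
  by rewrite addrC lamD // addrC.
- by rewrite (@lamE _ 1%N 1) // expr1 expr1z; apply: vassoc_refl.
- move=> x nz_x; have [NP _] := NkP x nz_x; exists (Nk x).1 => //.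
  case/andP: NP => N_gt0 _.
  by rewrite /lam (negPf nz_x) mulrC mulfVK ?pnatr_eq0 -?lt0n // rpredN intr_int.
Qed.

Definition lam (p : nat) : algC -> rat :=
  ClassicalEpsilon.epsilon (inhabits (fun=> 0)) (is_logval p).

Section Lam.
Variables (p : nat) (pr_p : prime p).

Lemma lamP : is_logval p (lam p).
Proof. exact: ClassicalEpsilon.epsilon_spec (exists_logval pr_p). Qed.

Lemma lam0 : lam p 0 = 0. Proof. by case: lamP. Qed.
Lemma lamM x y : x != 0 -> y != 0 -> lam p (x * y) = lam p x + lam p y.
Proof. by case: lamP => _ + _ _ _; apply. Qed.
Lemma lam_prime : lam p p%:R = -1. Proof. by case: lamP. Qed.
Lemma lam_denom x : x != 0 ->
  exists2 N, (0 < N <= size (conjs x))%N & N%:R * lam p x \in Num.int.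
Proof. by case: lamP => _ _ _ _; apply. Qed.

Lemma lam1 : lam p 1 = 0.
Proof. by apply: (addrI (lam p 1)); rewrite -lamM ?oner_neq0 // mulr1 addr0. Qed.

Lemma lamX x n : x != 0 -> lam p (x ^+ n) = lam p x *+ n.
Proof.
move=> nz_x; elim: n => [|n IH]; first by rewrite lam1.
by rewrite exprS lamM ?expf_neq0 // IH mulrS.
Qed.

Lemma lamV x : x != 0 -> lam p x^-1 = - lam p x.
Proof.
move=> nz_x; apply/eqP; rewrite -addr_eq0 addrC -lamM ?invr_eq0 //.
by rewrite divff // lam1.
Qed.

Lemma lamXz x (k : int) : x != 0 -> lam p (x ^ k) = lam p x *~ k.
Proof.
by case: k => n nz_x; rewrite ?NegzE -?exprnN ?lamV ?expf_neq0 // lamX // mulrNz.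
Qed.

Lemma lamN1 : lam p (-1) = 0.
Proof.
have := lamX 2 (_ : -1 != 0 :> algC); rewrite sqrrN expr1n lam1 oppr_eq0 oner_neq0.
by move=> /(_ isT)/esym/eqP; rewrite mulrn_eq0 => /eqP.
Qed.

Lemma lamN x : lam p (- x) = lam p x.
Proof.
have [->|nz_x] := eqVneq x 0; first by rewrite oppr0.
by rewrite -mulN1r lamM ?lamN1 ?add0r // oppr_eq0 oner_neq0.
Qed.

Lemma lam_prod (I : Type) (r : seq I) (P : pred I) (F : I -> algC) :
  (forall i, P i -> F i != 0) ->
  lam p (\prod_(i <- r | P i) F i) = \sum_(i <- r | P i) lam p (F i).
Proof.
move=> nzF; elim: r => [|i r IH]; first by rewrite !big_nil lam1.
rewrite !big_cons; case: ifP => // Pi; rewrite lamM ?IH ?nzF //.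
elim: (r) => [|j s nz]; rewrite ?big_nil ?oner_neq0 // big_cons.
by case: ifP => // Pj; rewrite mulf_neq0 ?nzF.
Qed.

Lemma lam_Dle c x y : (x != 0 -> lam p x <= c) -> (y != 0 -> lam p y <= c) ->
  x + y != 0 -> lam p (x + y) <= c.
Proof.
have [->|nx] := eqVneq x 0; first by rewrite add0r => _ yc /yc.
have [->|ny] := eqVneq y 0; first by rewrite addr0 => xc _ _; apply: xc.
move=> /(_ isT) xc /(_ isT) yc nxy; case: lamP => _ _ /(_ x y nx ny nxy) + _ _.
by move/le_trans; apply; rewrite ge_max xc.
Qed.

Definition lam_ring : set algC := [set x | lam p x <= 0].

Lemma lam_ring_subring : is_subring lam_ring.
Proof.
split=> [|x y|x y]; rewrite /lam_ring /=; first by rewrite lam1.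
- move=> x_le y_le; have [->|nxy] := eqVneq (x - y) 0; first by rewrite lam0.
  by apply: lam_Dle => // _; rewrite ?lamN.
- have [->|nx] := eqVneq x 0; first by rewrite mul0r lam0.
  have [->|ny] := eqVneq y 0; first by rewrite mulr0 lam0.
  by rewrite lamM // => xc yc; rewrite -[0]addr0 lerD.
Qed.

Lemma lam_nat n : lam p n%:R <= 0.
Proof. exact: (subring_nat lam_ring_subring). Qed.

Lemma lam_int (z : int) : lam p z%:~R <= 0.
Proof. by case: z => n; rewrite ?NegzE ?rmorphN ?lamN lam_nat. Qed.

Lemma lam_coprime m : coprime p m -> lam p m%:R = 0.
Proof.
move=> pm; have m_gt0 : (0 < m)%N.
  by case: m pm => //; rewrite /coprime gcdn0 => /eqP p1; move: pr_p; rewrite p1.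
apply/eqP; rewrite eq_le lam_nat leNgt; apply/negP => lt0.
have nz_m : m%:R != 0 :> algC by rewrite pnatr_eq0 -lt0n.
have nz_p : p%:R != 0 :> algC by rewrite pnatr_eq0 -lt0n prime_gt0.
have [u v Duv _] := egcdnP p m_gt0; rewrite gcdnC (eqP pm) in Duv.
have {}Duv : 1 = u%:R * m%:R - v%:R * p%:R :> algC.
  by rewrite -!natrM Duv addn1 -natr1 addrAC subrr add0r.
pose c := Num.max (lam p m%:R) (-1).
suff : lam p 1 <= c by rewrite lam1 leNgt gt_max lt0.
have aux (k n : nat) : lam p n%:R <= c -> k%:R * n%:R != 0 :> algC -> lam p (k%:R * n%:R) <= c.
  rewrite mulf_eq0 => nc /norP[nk nn]; rewrite lamM // (le_trans _ nc) //.
  by rewrite gerDr lam_nat.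
rewrite Duv; apply: lam_Dle; rewrite ?oppr_eq0 ?lamN -?Duv ?oner_neq0 //; apply: aux.
  by rewrite le_max lexx.
by rewrite lam_prime le_max lexx orbT.
Qed.

Lemma lam_natE n : (0 < n)%N -> lam p n%:R = - (logn p n)%:R.
Proof.
move=> n_gt0; have [m pm {1}->] := pfactor_coprime pr_p n_gt0.
have m_gt0 : (0 < m)%N.
  by case: m pm => //; rewrite /coprime gcdn0 => /eqP p1; move: pr_p; rewrite p1.
have nz_p : p%:R != 0 :> algC by rewrite pnatr_eq0 -lt0n prime_gt0.
rewrite natrM lamM ?pnatr_eq0 -?lt0n ?expn_gt0 ?(prime_gt0 pr_p) //.
by rewrite lam_coprime // add0r natrX lamX // lam_prime mulNrn.
Qed.

Lemma lam_ratr (a : rat) : a != 0 ->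
  lam p (QtoC a) = (logn p `|denq a|)%:R - (logn p `|numq a|)%:R.
Proof.
move=> nz_a; have int_nz (z : int) : z != 0 -> lam p z%:~R = - (logn p `|z|)%:R.
  case: z => n nz; first by rewrite lam_natE // lt0n.
  by rewrite NegzE rmorphN lamN lam_natE.
rewrite /ratr lamM ?lamV ?invr_eq0 ?intr_eq0 ?numq_eq0 ?denq_eq0 //.
by rewrite !int_nz ?numq_eq0 ?denq_eq0 // opprK addrC.
Qed.

Lemma lam_monic_root (P : {poly algC}) x : P \is monic ->
  (forall i, lam p P`_i <= 0) -> root P x -> lam p x <= 0.
Proof.
move=> mP Pi /rootP Px; rewrite leNgt; apply/negP => x_gt0.
have nz_x : x != 0 by apply: contraTneq x_gt0 => ->; rewrite lam0 ltxx.
have P_gt0 : (0 < size P)%N by rewrite size_poly_gt0 monic_neq0.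
move: Px; rewrite horner_coef; case Dn: (size P) P_gt0 => [//|n] _.
rewrite big_ord_recr /= -[P`_n]/(P`_n.+1.-1) -Dn -/(lead_coef P) (monicP mP) mul1r.
move/eqP; rewrite addrC addr_eq0 => /eqP Dxn.
have lamxn : lam p (x ^+ n) = lam p x *+ n by rewrite lamX.
suff : forall m, (m <= n)%N -> \sum_(i < m) P`_i * x ^+ i != 0 ->
    lam p (\sum_(i < m) P`_i * x ^+ i) <= lam p x *+ n.-1.
  move/(_ n (leqnn n)); rewrite -oppr_eq0 -Dxn expf_neq0 // => /(_ isT).
  rewrite -lamN -Dxn lamxn; case: (n) Dxn => [|k _].
    by rewrite expr0 big_ord0 oppr0 => /eqP; rewrite oner_eq0.
  by rewrite mulrS gerDr leNgt x_gt0.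
elim=> [|m IH] lt_m; first by rewrite big_ord0 eqxx.
rewrite big_ord_recr /=; apply: lam_Dle; first exact: IH (ltnW lt_m).
rewrite mulf_eq0 => /norP[nzP nzx]; rewrite lamM // lamX //.
apply: le_trans (_ : lam p x *+ m <= _); first by rewrite gerDr.
by apply: ler_wpMn2l; [apply: ltW | case: (n) lt_m].
Qed.

Lemma lam_Aint x : x \in Aint -> lam p x <= 0.
Proof.
move=> Ax; apply: lam_monic_root (minCpoly_monic x) _ (root_minCpoly x) => i.
by have /intrP[z ->] := polyOverP Ax i; apply: lam_int.
Qed.

Lemma lam_minCpoly_coef x : (forall s : Gal, lam p (s x) <= 0) ->
  forall i, lam p (minCpoly x)`_i <= 0.
Proof.
move=> sx; rewrite minCpoly_conjs; have sR := lam_ring_subring.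
have : {in conjs x, forall t, lam p t <= 0} by move=> t /conj_autP[s <-].
elim: (conjs x) => [|t r IH] tr i.
  by rewrite big_nil coef1; case: eqP; rewrite ?lam1 ?lam0.
rewrite big_cons mulrBl coefB coefXM coefCM.
have /IH{}IH : {in r, forall u, lam p u <= 0}.
  by move=> u ur; apply: tr; rewrite inE ur orbT.
apply: (subringB sR); last first.
  by apply: (subringM sR); [apply: tr; rewrite mem_head | apply: IH].
by case: eqP => _; [apply: (subring0 sR) | apply: IH].
Qed.

End Lam.

Lemma Aint_lam x : (forall p (s : Gal), prime p -> lam p (s x) <= 0) -> x \in Aint.
Proof.
move=> x_le; have [q [Dq _] _] := minCpolyP x.
apply/polyOverP => i; rewrite Dq coef_map /= Cint_rat.
have [->|nz_a] := eqVneq q`_i 0; first exact: rpred0.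
rewrite Qint_def; apply: contraT => d1.
have : (1 < `|denq q`_i|)%N.
  rewrite ltn_neqAle absz_gt0 denq_neq0 andbT eq_sym; apply: contra d1 => /eqP d1.
  by rewrite -[denq _]gez0_abs ?denq_ge0 // d1.
case/pdivP=> p pr_p p_dv.
have := lam_minCpoly_coef pr_p (fun s => x_le p s pr_p) i.
rewrite Dq coef_map /= lam_ratr // subr_le0 ler_nat leqNgt => /negP[].
have := coprime_num_den q`_i.
rewrite coprime_sym => /(coprime_dvdl p_dv); rewrite prime_coprime // => p_num.
rewrite (_ : logn p `|numq q`_i| = 0)%N; last by rewrite lognE (negPf p_num) !andbF.
by rewrite logn_gt0 mem_primes pr_p absz_gt0 denq_neq0.
Qed.

Lemma Aunit_lam x : x != 0 -> (forall p (s : Gal), prime p -> lam p (s x) = 0) -> Aunit x.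
Proof.
move=> nz_x x0; split; last split=> //.
  by apply: Aint_lam => p s pr_p; rewrite x0.
apply: Aint_lam => p s pr_p.
by rewrite fmorphV lamV ?x0 ?oppr0 // fmorph_eq0.
Qed.

Lemma lam_Aunit p u : prime p -> Aunit u -> lam p u = 0.
Proof.
move=> pr_p [Au [Aiu nz_u]]; apply/eqP; rewrite eq_le lam_Aint //=.
by rewrite -oppr_le0 -lamV // lam_Aint.
Qed.

(** * Places of number fields *)

Section RealLog.
Implicit Types x y : RR.

Definition rexp (x : RR) : RR := Rtrigo_def.exp x.

Lemma rexpD x y : rexp (x + y) = rexp x * rexp y. Proof. exact: Exp_prop.exp_plus. Qed.
Lemma rexp_gt0 x : 0 < rexp x. Proof. by apply/RltP; apply: Exp_prop.exp_pos. Qed.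
Lemma rexp0 : rexp 0 = 1. Proof. exact: Rtrigo_def.exp_0. Qed.
Lemma rlogK x : 0 < x -> rexp (rlog x) = x.
Proof. by move/RltP; apply: Rpower.exp_ln. Qed.
Lemma rexpK x : rlog (rexp x) = x. Proof. exact: Rpower.ln_exp. Qed.
Lemma ler_rexp x y : (rexp x <= rexp y) = (x <= y).
Proof.
apply/idP/idP => [|]; last first.
  rewrite le_eqVlt => /orP[/eqP -> //|/RltP xy]; apply/ltW/RltP.
  exact: Rpower.exp_increasing.
by apply: contraTT; rewrite -!ltNge => /RltP yx; apply/RltP; apply: Rpower.exp_increasing.
Qed.
Lemma rlog1 : rlog 1 = 0. Proof. exact: Rpower.ln_1. Qed.
Lemma rlog_gt0 x : 1 < x -> 0 < rlog x.
Proof.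
move=> /[dup]/(lt_trans ltr01) x0 x1.
by rewrite ltNge -ler_rexp rlogK // rexp0 -ltNge.
Qed.
End RealLog.

Lemma rlog_prime_gt0 p : prime p -> 0 < rlog p%:R.
Proof. by move=> pr_p; apply: rlog_gt0; rewrite ltr1n prime_gt1. Qed.

Definition wabs (p : nat) (x : algC) : RR :=
  if x == 0 then 0 else rexp (ratr (lam p x) * rlog p%:R).

Definition place (K : pred algC) (p : nat) (s : Gal) (x : algC) : RR :=
  if K x then wabs p (s x) else 0.

Lemma rlog_wabs p x : x != 0 -> rlog (wabs p x) = ratr (lam p x) * rlog p%:R.
Proof. by rewrite /wabs => /negPf ->; rewrite rexpK. Qed.

Section Subfield.
Variables (K : pred algC) (sK : is_subfield K).

Lemma subfield1 : K 1. Proof. by case: sK. Qed.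
Lemma subfieldB x y : K x -> K y -> K (x - y). Proof. by case: sK => _ + _ _; apply. Qed.
Lemma subfieldM x y : K x -> K y -> K (x * y). Proof. by case: sK => _ _ + _; apply. Qed.
Lemma subfieldV x : K x -> K x^-1. Proof. by case: sK => _ _ _; apply. Qed.
Let sR : is_subring [set x | K x]%classic.
Proof. by split; [exact: subfield1 | exact: subfieldB | exact: subfieldM]. Qed.
Lemma subfield0 : K 0. Proof. exact: (subring0 sR). Qed.
Lemma subfieldN x : K x -> K (- x). Proof. exact: (subringN sR). Qed.
Lemma subfieldD x y : K x -> K y -> K (x + y). Proof. exact: (subringD sR). Qed.
Lemma subfieldX x n : K x -> K (x ^+ n). Proof. exact: (subringX sR). Qed.
Lemma subfield_sum (I : Type) (r : seq I) (P : pred I) (F : I -> algC) :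
  (forall i, P i -> K (F i)) -> K (\sum_(i <- r | P i) F i).
Proof. exact: (subring_sum sR). Qed.
Lemma subfield_nat n : K n%:R. Proof. exact: (subring_nat sR). Qed.
Lemma subfield_int (z : int) : K z%:~R.
Proof. by case: z => n; rewrite ?NegzE ?rmorphN /=; [|apply: subfieldN]; apply: subfield_nat. Qed.
Lemma subfield_ratr (a : rat) : K (QtoC a).
Proof. by apply: subfieldM; [|apply: subfieldV]; apply: subfield_int. Qed.
End Subfield.

Lemma is_subfield_predT : is_subfield predT. Proof. by []. Qed.

Lemma number_field_primitive K : number_field K ->
  exists2 th, K th & forall x, K x -> Qadjoin th x.
Proof.
case=> sK [s [sub spn _]]; pose th := primitive_elt s.
have Kth : K th.
  rewrite /th /primitive_elt; case: algC_PET => z [a Dz] _ /=.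
  rewrite Dz; apply: subfield_sum => // i _; rewrite -mulr_natr.
  apply: subfieldM => //; last exact: subfield_nat.
  by apply: (allP sub); rewrite mem_nth.
exists th => // x /spn[q ->]; rewrite /rat_comb.
apply: (big_ind (Qadjoin th)) => [||i _]; last apply: QadjoinM.
- by rewrite -(rmorph0 QtoC); apply: Qadjoin_rat.
- exact: QadjoinD.
- exact: Qadjoin_rat.
- by apply: Qadjoin_primitive; rewrite mem_nth.
Qed.

Lemma place_is_place K p (s : Gal) : is_subfield K -> prime p ->
  is_place_over K p (place K p s).
Proof.
move=> sK pr_p; have lp := rlog_prime_gt0 pr_p.
have wM x y : wabs p (x * y) = wabs p x * wabs p y.
  rewrite /wabs mulf_eq0; case: eqVneq => /= [_|nx]; first by rewrite mul0r.
  case: eqVneq => /= [_|ny]; first by rewrite mulr0.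
  by rewrite lamM // rmorphD mulrDl rexpD.
split=> // [x|x|x Kx|].
- by rewrite /place => /negPf ->.
- by rewrite /place /wabs; do 2!case: ifP => // _; apply/ltW/rexp_gt0.
- rewrite /place Kx /wabs fmorph_eq0; case: eqVneq => [//|nx]; split=> [/eqP|x0].
    by rewrite gt_eqF ?rexp_gt0.
  by rewrite x0 eqxx in nx.
split=> [x y Kx Ky|x y Kx Ky|].
- by rewrite /place Kx Ky subfieldM // rmorphM wM.
- rewrite /place Kx Ky subfieldD // rmorphD.
  move: (s x) (s y) => {Kx Ky}{}x {}y.
  have [->|nx] := eqVneq x 0; first by rewrite add0r le_max lexx orbT.
  have [->|ny] := eqVneq y 0; first by rewrite addr0 le_max lexx.
  rewrite /wabs (negPf nx) (negPf ny); case: eqVneq => [_|nxy].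
    by rewrite le_max ltW ?rexp_gt0.
  rewrite le_max !ler_rexp !ler_pM2r // !ler_rat -le_max.
  by case: (lamP pr_p) => _ _ + _ _; apply.
- rewrite /place subfield_nat // rmorph_nat /wabs pnatr_eq0.
  rewrite -[p == 0%N]negbK -lt0n prime_gt0 //= lam_prime //.
  rewrite rmorphN1 mulN1r; apply: (mulfI (_ : p%:R != 0)).
    by rewrite pnatr_eq0 -lt0n prime_gt0.
  rewrite divff ?pnatr_eq0 -?lt0n ?prime_gt0 //.
  by rewrite -{1}(rlogK (_ : 0 < p%:R)) ?ltr0n ?prime_gt0 // -rexpD subrr rexp0.
Qed.

Section Place.
Variables (K : pred algC) (sK : is_subfield K) (p : nat) (v : algC -> RR).
Hypothesis pl : is_place_over K p v.

Lemma place_primeP : prime p. Proof. by case: pl. Qed.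
Lemma place_outside x : ~~ K x -> v x = 0. Proof. by case: pl => _ + _ _ _; apply. Qed.
Lemma place_ge0 x : 0 <= v x. Proof. by case: pl => _ _ + _ _; apply. Qed.
Lemma place_eq0 x : K x -> v x = 0 <-> x = 0. Proof. by case: pl => _ _ _ + _; apply. Qed.
Lemma placeM x y : K x -> K y -> v (x * y) = v x * v y.
Proof. by case: pl => _ _ _ _ [+ _ _]; apply. Qed.
Lemma placeD x y : K x -> K y -> v (x + y) <= Num.max (v x) (v y).
Proof. by case: pl => _ _ _ _ [_ + _]; apply. Qed.
Lemma place_p : v p%:R = p%:R^-1. Proof. by case: pl => _ _ _ _ []. Qed.
Lemma place0 : v 0 = 0. Proof. by apply/(place_eq0 (subfield0 sK)). Qed.
Lemma place_neq0 x : K x -> x != 0 -> v x != 0.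
Proof. by move=> Kx; apply: contra => /eqP/(place_eq0 Kx) ->. Qed.
Lemma place_gt0 x : K x -> x != 0 -> 0 < v x.
Proof. by move=> Kx nx; rewrite lt_def place_ge0 place_neq0. Qed.
Lemma place1 : v 1 = 1.
Proof.
have K1 := subfield1 sK; apply: (mulfI (place_neq0 K1 (oner_neq0 _))).
by rewrite -placeM // !mulr1.
Qed.
Lemma placeX x n : K x -> v (x ^+ n) = v x ^+ n.
Proof.
move=> Kx; elim: n => [|n IH]; first by rewrite place1.
by rewrite !exprS placeM ?IH //; apply: subfieldX.
Qed.
Lemma placeV x : K x -> v x^-1 = (v x)^-1.
Proof.
move=> Kx; have [->|nx] := eqVneq x 0; first by rewrite invr0 place0 invr0.
apply: (mulfI (place_neq0 Kx nx)); rewrite -placeM ?subfieldV //.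
by rewrite !divff ?place1 ?place_neq0.
Qed.
Lemma placeN x : K x -> v (- x) = v x.
Proof.
move=> Kx; have KN1 : K (- 1) by apply: (subfieldN sK); apply: subfield1.
rewrite -mulN1r placeM //; suff -> : v (-1) = 1 by rewrite mul1r.
apply/eqP; rewrite -(@eqrXn2 _ 2) ?place_ge0 //.
by rewrite -placeX // sqrrN expr1n place1 expr1n.
Qed.
Lemma placeB x y : K x -> K y -> v (x - y) <= Num.max (v x) (v y).
Proof. by move=> Kx Ky; rewrite -(placeN Ky); apply: placeD => //; apply: subfieldN. Qed.
Lemma placeD_lt x y c : K x -> K y -> v x < c -> v y < c -> v (x + y) < c.
Proof. by move=> Kx Ky xc yc; rewrite (le_lt_trans (placeD Kx Ky)) // gt_max xc. Qed.
Lemma placeD_le x y c : K x -> K y -> v x <= c -> v y <= c -> v (x + y) <= c.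
Proof. by move=> Kx Ky xc yc; rewrite (le_trans (placeD Kx Ky)) // ge_max xc. Qed.
Lemma placeDl x y : K x -> K y -> v x < v y -> v (x + y) = v y.
Proof.
move=> Kx Ky xy; apply/eqP; rewrite eq_le placeD_le // ?(ltW xy) //=.
have Kxy := subfieldD sK Kx Ky; rewrite leNgt; apply/negP => lt_y.
have := placeD_lt Kxy (subfieldN sK Kx) lt_y; rewrite placeN // => /(_ xy).
by rewrite addrAC subrr add0r ltxx.
Qed.
Lemma place_sum_le (I : Type) (r : seq I) (P : pred I) (F : I -> algC) c : 0 <= c ->
  (forall i, P i -> K (F i)) -> (forall i, P i -> v (F i) <= c) ->
  v (\sum_(i <- r | P i) F i) <= c.
Proof.
move=> c_ge0 KF Fc; set S := \sum_(i <- r | P i) F i.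
suff /andP[] : K S && (v S <= c) by [].
apply: (big_ind (fun x => K x && (v x <= c))) => [|x y /andP[Kx xc] /andP[Ky yc]|i Pi].
- by rewrite subfield0 // place0.
- by rewrite subfieldD //= placeD_le.
- by rewrite KF // Fc.
Qed.
Lemma place_nat n : v n%:R <= 1.
Proof.
elim: n => [|n IH]; first by rewrite place0 ler01.
by rewrite -natr1 placeD_le ?place1 ?subfield_nat ?subfield1.
Qed.
Lemma place_int (z : int) : v z%:~R <= 1.
Proof. by case: z => n; rewrite ?NegzE ?rmorphN /= ?placeN ?subfield_nat ?place_nat. Qed.
Lemma place_p_lt1 : v p%:R < 1.
Proof. by rewrite place_p invf_lt1 ?ltr0n ?ltr1n ?prime_gt1 ?prime_gt0 ?place_primeP. Qed.
Lemma place_coprime m : coprime p m -> v m%:R = 1.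
Proof.
move=> pm; have m_gt0 : (0 < m)%N.
  by case: m pm => //; rewrite /coprime gcdn0 => /eqP p1; move: place_primeP; rewrite p1.
apply/eqP; rewrite eq_le place_nat leNgt; apply/negP => lt1.
have [a b Dab _] := egcdnP p m_gt0; rewrite gcdnC (eqP pm) in Dab.
have {}Dab : 1 = a%:R * m%:R - b%:R * p%:R :> algC.
  by rewrite -!natrM Dab addn1 -natr1 addrAC subrr add0r.
have Kn := subfield_nat sK; have KM := subfieldM sK.
suff : v 1 < 1 by rewrite place1 ltxx.
rewrite Dab; apply: placeD_lt; rewrite ?placeN ?placeM //; try exact: KM.
- by apply: (subfieldN sK); apply: KM.
- by rewrite (le_lt_trans _ lt1) // ler_piMl ?place_ge0 ?place_nat.
- by rewrite (le_lt_trans _ place_p_lt1) // ler_piMl ?place_ge0 ?place_nat.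
Qed.
Lemma place_natE n : (0 < n)%N -> v n%:R = p%:R^-1 ^+ logn p n.
Proof.
move=> n_gt0; have [m pm {1}->] := pfactor_coprime place_primeP n_gt0.
have Kn := subfield_nat sK.
by rewrite natrM placeM // place_coprime // mul1r natrX placeX // place_p.
Qed.
Lemma place_ratr (a : rat) : a != 0 ->
  v (QtoC a) = p%:R^-1 ^+ logn p `|numq a| / p%:R^-1 ^+ logn p `|denq a|.
Proof.
move=> nz_a; have Kz := subfield_int sK.
have int_nz (z : int) : z != 0 -> v z%:~R = p%:R^-1 ^+ logn p `|z|.
  case: z => n nz; first by rewrite place_natE // lt0n.
  by rewrite NegzE rmorphN placeN ?place_natE //; apply: subfield_nat.
rewrite /ratr placeM ?placeV //; last exact: subfieldV.
by rewrite !int_nz ?numq_eq0 ?denq_eq0.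
Qed.
Lemma place_monic_root (P : {poly algC}) x : P \is monic ->
  (forall i, K P`_i) -> (forall i, v P`_i <= 1) -> K x -> root P x -> v x <= 1.
Proof.
move=> mP KP Pi Kx /rootP Px; rewrite leNgt; apply/negP => x_gt1.
have P_gt0 : (0 < size P)%N by rewrite size_poly_gt0 monic_neq0.
move: Px; rewrite horner_coef; case Dn: (size P) P_gt0 => [//|n] _.
rewrite big_ord_recr /= -[P`_n]/(P`_n.+1.-1) -Dn -/(lead_coef P) (monicP mP) mul1r.
move/eqP; rewrite addrC addr_eq0 => /eqP Dxn.
have KF (i : 'I_n) : K (P`_i * x ^+ i) by apply: subfieldM => //; apply: subfieldX.
have := placeX n Kx; rewrite Dxn placeN; last exact: subfield_sum.
case: n Dxn KF {Dn} => [|n] Dxn KF.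
  by move: Dxn => /eqP; rewrite expr0 big_ord0 oppr0 oner_eq0.
move=> E; have : v (\sum_(i < n.+1) P`_i * x ^+ i) <= v x ^+ n.
  apply: place_sum_le => [|//|i _]; first by rewrite exprn_ge0 ?place_ge0.
  rewrite placeM ?placeX //; last exact: subfieldX.
  rewrite (le_trans (ler_piMl _ (Pi i))) ?exprn_ge0 ?place_ge0 //.
  by rewrite ler_weXn2l ?ltW // -ltnS.
have xn_gt0 : 0 < v x ^+ n by rewrite exprn_gt0 // (lt_trans ltr01).
by rewrite E exprS leNgt ltr_pMl // x_gt1.
Qed.
End Place.

Lemma place_over_inj K p q v : is_subfield K -> is_place_over K p v ->
  is_place_over K q v -> p = q.
Proof.
move=> sK pv qv; have [pr_p pr_q] := (place_primeP pv, place_primeP qv).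
apply/eqP; apply: contraT => npq.
have := place_p_lt1 pv; rewrite (place_coprime sK qv) ?ltxx //.
by rewrite prime_coprime // dvdn_prime2 // eq_sym.
Qed.

Lemma prime_belowE K p v : is_subfield K -> is_place_over K p v -> prime_below K v = p.
Proof.
move=> sK pv; apply: (place_over_inj sK _ pv).
by apply: (ClassicalEpsilon.epsilon_spec _ (fun q => is_place_over K q v)); exists p.
Qed.

Lemma place_ratr_eq K L p v w a : is_subfield K -> is_subfield L ->
  is_place_over K p v -> is_place_over L p w -> v (QtoC a) = w (QtoC a).
Proof.
move=> sK sL pv pw; have [->|nz_a] := eqVneq a 0.
  by rewrite rmorph0 (place0 sK pv) (place0 sL pw).
by rewrite (place_ratr sK pv) // (place_ratr sL pw).
Qed.

Lemma expr_small (r C : RR) : 0 <= r < 1 ->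
  exists m, forall n, (m <= n)%N -> r ^+ n * C < 1.
Proof.
move=> /andP[r0 r1]; have [C0|C0] := leP C 0.
  by exists 0%N => n _; rewrite (le_lt_trans _ ltr01) // mulr_ge0_le0 ?exprn_ge0.
have r_lt : Rdefinitions.Rlt (Rbasic_fun.Rabs r) 1 by apply/RltP; rewrite RabsE ger0_norm.
have Ci : Rdefinitions.Rlt 0 C^-1 by apply/RltP; rewrite invr_gt0.
have [N NP] := Rfunctions.pow_lt_1_zero r r_lt C^-1 Ci.
exists N => n /ssrnat.leP Nn; have /RltP := NP n Nn.
by rewrite RabsE RpowE ger0_norm ?exprn_ge0 // -ltr_pdivlMr ?div1r.
Qed.

Section Approximation.
Variables (K : pred algC) (sK : is_subfield K) (p : nat) (v : algC -> RR).
Hypothesis pv : is_place_over K p v.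

Lemma place_separate (w : algC -> RR) :
  is_place_over K p w -> (exists2 a, K a & v a <> w a) ->
  (forall a, K a -> a != 0 -> exists2 N, (0 < N)%N & exists k : int, w a ^+ N = p%:R ^ k) ->
  exists2 c, K c & w c < 1 < v c.
Proof.
move=> pw [a Ka vwa] disc; have pr_p := place_primeP pv.
have nz_p : p%:R != 0 :> algC by rewrite pnatr_eq0 -lt0n prime_gt0.
have nz_pR : p%:R != 0 :> RR by rewrite pnatr_eq0 -lt0n prime_gt0.
have nz_a : a != 0 by apply/eqP => a0; apply: vwa; rewrite a0 (place0 sK pv) (place0 sK pw).
have [N N_gt0 [k wk]] := disc a Ka nz_a.
have Kp : K p%:R by apply: subfield_nat.
have KX n : K (p%:R ^ n).
  by case: n => n; rewrite ?NegzE -?exprnN -?exprnP -natrX ?(subfieldV sK) ?subfield_nat.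
have vpz u : is_place_over K p u -> u (p%:R ^ k) = (p%:R ^ k)^-1.
  move=> pu; case: k {wk} => n; rewrite ?NegzE -?exprnN -?exprnP.
    by rewrite (placeX sK pu) // (place_p pu) exprVn.
  by rewrite (placeV sK pu) ?(placeX sK pu) ?(subfieldX sK) // (place_p pu) exprVn.
pose b := a ^+ N * p%:R ^ k.
have Kb : K b by apply: subfieldM => //; apply: subfieldX.
have ub u : is_place_over K p u -> u b = u a ^+ N * (p%:R ^ k)^-1.
  by move=> pu; rewrite (placeM pu) ?(placeX sK pu) ?(subfieldX sK) // vpz.
have wb : w b = 1 by rewrite ub // wk divff // expfz_neq0.
have nz_b : b != 0 by rewrite mulf_neq0 ?expf_neq0 ?expfz_neq0.
have vb : v b != 1.
  apply/eqP => vb; apply: vwa; apply/eqP; rewrite -(@eqrXn2 _ N) ?(place_ge0 pv) ?(place_ge0 pw) //.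
  apply/eqP; apply: (mulIf (_ : (p%:R ^ k)^-1 != 0)); first by rewrite invr_eq0 expfz_neq0.
  by rewrite -!ub // vb.
have [c Kc [wc vc]] : exists2 c, K c & w c = 1 /\ v c > 1.
  have [vb_gt|vb_lt|/eqP] := ltgtP (v b) 1; last by rewrite (negPf vb).
    exists b^-1; rewrite ?(subfieldV sK) // (placeV sK pw) // (placeV sK pv) // wb invr1.
    by split=> //; rewrite invf_gt1 // (place_gt0 pv).
  by exists b.
have [|m mP] := @expr_small (v c)^-1 p%:R.
  by rewrite invr_ge0 (place_ge0 pv) invf_lt1 // (lt_trans ltr01).
exists (c ^+ m * p%:R); first by apply: subfieldM => //; apply: subfieldX.
rewrite (placeM pv) ?(placeM pw) ?(subfieldX sK) // (placeX sK pv) // (placeX sK pw) //.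
rewrite wc expr1n mul1r (place_p_lt1 pw) (place_p pv) /=.
have vcm : 0 < v c ^+ m by rewrite exprn_gt0 // (lt_trans ltr01 vc).
have := mP m (leqnn m); rewrite exprVn mulrC ltr_pdivrMr // mul1r => lt1.
by rewrite ltr_pdivlMr ?ltr0n ?prime_gt0 // mul1r.
Qed.

Lemma place_approximation (ws : nat -> algC -> RR) n :
  (forall i, (i < n)%N -> is_place_over K p (ws i)) ->
  (forall i, (i < n)%N -> exists2 c, K c & ws i c < 1 < v c) ->
  exists2 x, K x & v x > 1 /\ forall i, (i < n)%N -> ws i x < 1.
Proof.
elim: n => [|n IH] pws sep.
  exists p%:R^-1; first by apply: (subfieldV sK); apply: subfield_nat.
  split=> //; rewrite (placeV sK pv) ?subfield_nat // (place_p pv) invrK ltr1n.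
  exact/prime_gt1/(place_primeP pv).
have [||x Kx [vx wx]] := IH; [by move=> i /ltnW/pws | by move=> i /ltnW/sep |].
have [c Kc /andP[wc vc]] := sep n (ltnSn n); set w := ws n in wc.
have pw : is_place_over K p w by apply: pws.
have [m mP] : exists m, (0 < m)%N /\ forall i, (i < n)%N -> ws i x ^+ m * ws i c < 1.
  suff [m mP] : exists m, forall i, (i < n)%N -> forall k, (m <= k)%N -> ws i x ^+ k * ws i c < 1.
    by exists m.+1; split=> // i /mP; apply.
  elim: (n) pws wx => [|k IHk] pws wx; first by exists 0%N.
  have [||m mP] := IHk; [by move=> i /ltnW/pws | by move=> i /ltnW/wx |].
  have [|m' m'P] := @expr_small (ws k x) (ws k c).
    by rewrite (place_ge0 (pws k _)) ?wx // ltnW.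
  exists (maxn m m') => i; rewrite ltnS leq_eqVlt => /orP[/eqP ->|ik] j.
    by rewrite geq_max => /andP[_ /m'P].
  by rewrite geq_max => /andP[+ _]; apply: mP.
case: mP => m_gt0 mP; have Kxm : K (x ^+ m) by apply: subfieldX.
have K1 := subfield1 sK.
have vxm : 1 < v (x ^+ m) by rewrite (placeX sK pv) // exprn_egt1 // -lt0n.
have [wx_le|wx_gt] := leP (w x) 1.
  exists (x ^+ m * c); first exact: subfieldM.
  rewrite (placeM pv) //; split=> [|i].
    by rewrite -[1]mulr1 ltr_pM ?ltr01.
  rewrite ltnS leq_eqVlt => /orP[/eqP ->|ik]; rewrite -/w.
    rewrite (placeM pw) // (placeX sK pw) // (le_lt_trans _ wc) //.
    by rewrite ler_piMl ?(place_ge0 pw) // exprn_ile1 ?(place_ge0 pw).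
  by have pwi := pws i (ltnW ik); rewrite (placeM pwi) // (placeX sK pwi) // mP.
have wxm : 1 < w (x ^+ m) by rewrite (placeX sK pw) // exprn_egt1 // -lt0n.
have big u : is_place_over K p u -> 1 < u (x ^+ m) -> u (x ^+ m / (1 + x ^+ m)) = 1.
  move=> pu ux; have K1x := subfieldD sK K1 Kxm.
  rewrite (placeM pu) ?(subfieldV sK) // (placeV sK pu) //.
  rewrite (placeDl sK pu) ?(place1 sK pu) // divff //.
  by rewrite gt_eqF // (lt_trans ltr01).
have K1x := subfieldD sK K1 Kxm.
have Ky : K (x ^+ m / (1 + x ^+ m)) by apply: subfieldM => //; apply: subfieldV.
exists (x ^+ m / (1 + x ^+ m) * c); first exact: subfieldM.
rewrite (placeM pv) // big // mul1r; split=> // i.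
rewrite ltnS leq_eqVlt => /orP[/eqP ->|ik]; rewrite -/w.
  by rewrite (placeM pw) // big // mul1r.
have pwi := pws i (ltnW ik).
have wixm : ws i (x ^+ m) < 1.
  by rewrite (placeX sK pwi) // exprn_ilt1 ?(place_ge0 pwi) ?wx // -lt0n.
rewrite (placeM pwi) // (placeM pwi) ?(subfieldV sK) // (placeV sK pwi) // addrC.
rewrite (placeDl sK pwi) ?(place1 sK pwi) // invr1 mulr1.
by rewrite (placeX sK pwi) // mP.
Qed.
End Approximation.

Lemma rexpX x n : rexp x ^+ n = rexp (x *+ n).
Proof.
elim: n => [|n IH]; first by rewrite rexp0.
by rewrite exprS IH -rexpD mulrS.
Qed.

Lemma prime_exprz p (k : int) : prime p -> p%:R ^ k = rexp (k%:~R * rlog p%:R).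
Proof.
move=> pr_p; have p_gt0 : 0 < p%:R :> RR by rewrite ltr0n prime_gt0.
have natE n : p%:R ^+ n = rexp (n%:R * rlog p%:R).
  by rewrite -{1}(rlogK p_gt0) rexpX mulr_natl.
case: k => n; first exact: natE.
rewrite NegzE -exprnN natE; apply: (mulfI (_ : rexp (n.+1%:R * rlog p%:R) != 0)).
  by rewrite gt_eqF ?rexp_gt0.
by rewrite divff ?gt_eqF ?rexp_gt0 // -rexpD rmorphN mulNr subrr rexp0.
Qed.

Lemma wabs_le1 p x : prime p -> (wabs p x <= 1) = (lam p x <= 0).
Proof.
move=> pr_p; rewrite /wabs; case: eqVneq => [->|nx]; first by rewrite lam0 // lexx ler01.
by rewrite -[X in _ <= X]rexp0 ler_rexp pmulr_lle0 ?rlog_prime_gt0 // lerq0.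
Qed.

Lemma place_disc (K : pred algC) p (s : Gal) a : prime p -> K a -> a != 0 ->
  exists2 N, (0 < N)%N & exists k : int, place K p s a ^+ N = p%:R ^ k.
Proof.
move=> pr_p Ka nz_a; have nz_sa : s a != 0 by rewrite fmorph_eq0.
have [N /andP[N_gt0 _] /intrP[k Dk]] := lam_denom pr_p nz_sa.
exists N => //; exists k; rewrite /place Ka /wabs (negPf nz_sa) rexpX prime_exprz //.
by rewrite -mulrnAl -rmorphMn -mulr_natl Dk /= ratr_int.
Qed.

Lemma place_conj K p v : number_field K -> is_place_over K p v ->
  exists s : Gal, v = place K p s.
Proof.
move=> nK pv; have sK := nK.1; have pr_p := place_primeP pv.
apply: contrapT => /forallNP nv.
have [th Kth gen] := number_field_primitive nK.
pose sg i := aut th (nth 0 (conjs th) i); pose ws i := place K p (sg i).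
have pws i : is_place_over K p (ws i) by apply: place_is_place.
have [i _|i _|x Kx [vx wx]] :=
  @place_approximation K sK p v pv ws (size (conjs th)).
- exact: pws.
- apply: (place_separate sK pv (pws i)); last by move=> a; apply: place_disc.
  apply: contrapT => /forall2NP nva; apply: (nv (sg i)); apply/funext => a.
  have [Ka|nKa] := boolP (K a); last by rewrite (place_outside pv) // /place ifN.
  by have [/(_ Ka)[]|/contrapT] := nva a.
have sx (s : Gal) : lam p (s x) <= 0.
  have /nthP-/(_ 0)[i lt_i Di] := conjs_aut s th.
  have -> : s x = sg i x by apply: aut_eq_Qadjoin (gen x Kx) _; rewrite /sg Di autE // conjs_aut.
  by rewrite -wabs_le1 // ltW //; have := wx i lt_i; rewrite /ws /place Kx.
have : v x <= 1; last by rewrite leNgt vx.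
apply: (place_monic_root sK pv (minCpoly_monic x) _ _ Kx (root_minCpoly x)) => i;
  have [q [Dq _] _] := minCpolyP x; have := lam_minCpoly_coef pr_p sx i;
  rewrite Dq coef_map /=; first by move=> _; apply: subfield_ratr.
have pT := place_is_place (idfun : Gal) is_subfield_predT pr_p.
by rewrite (place_ratr_eq _ sK is_subfield_predT pv pT) /place /= wabs_le1.
Qed.

Lemma place_Qadjoin_eq (K : pred algC) p (s t : Gal) th : (forall x, K x -> Qadjoin th x) ->
  s th = t th -> place K p s = place K p t.
Proof.
move=> gen st; apply/funext => x; rewrite /place; case: ifP => // Kx.
by rewrite (aut_eq_Qadjoin (gen x Kx) st).
Qed.

Lemma place_primeE K p s v : is_subfield K -> prime p -> place K p s = v ->
  prime_below K v = p.
Proof. by move=> sK pr_p <-; apply: prime_belowE => //; apply: place_is_place. Qed.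

Lemma is_place_prime K v : is_subfield K -> is_place K v ->
  is_place_over K (prime_below K v) v.
Proof. by move=> sK [p pv]; rewrite (prime_belowE sK pv). Qed.

Lemma In_map_mem (T : eqType) (U : Type) (f : T -> U) (s : seq T) u :
  List.In u (map f s) <-> exists2 t, t \in s & f t = u.
Proof.
elim: s => [|a s IH] /=; first by split=> // -[].
split=> [[fa|/IH[t ts ft]]|[t]].
- by exists a => //; rewrite mem_head.
- by exists t => //; rewrite inE ts orbT.
by rewrite inE => /orP[/eqP -> ->|ts ft]; [left | right; apply/IH; exists t].
Qed.

Lemma nodup_exists (T : Type) (s : seq T) :
  exists r, List.NoDup r /\ forall x, List.In x r <-> List.In x s.
Proof.
exists (List.nodup (fun x y : T => pselect (x = y)) s).
by split=> [|x]; [apply: List.NoDup_nodup | apply: List.nodup_In].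
Qed.

Lemma places_over K p : number_field K -> prime p ->
  exists ws, List.NoDup ws /\ forall w, List.In w ws <-> is_place_over K p w.
Proof.
move=> nK pr_p; have sK := nK.1; have [th Kth gen] := number_field_primitive nK.
have [ws [ws_uniq wsP]] := nodup_exists [seq place K p (aut th t) | t <- conjs th].
exists ws; split=> // w; rewrite wsP In_map_mem; split=> [[t _ <-]|].
  exact: place_is_place.
move=> /(place_conj nK)[s ->]; exists (s th); first exact: conjs_aut.
by apply: place_Qadjoin_eq gen _; rewrite autE ?conjs_aut.
Qed.

Lemma filter_exists (T : Type) (s : seq T) (P : T -> Prop) : List.NoDup s ->
  exists r, List.NoDup r /\ forall x, List.In x r <-> List.In x s /\ P x.
Proof.
move=> us; exists (List.filter (fun x => `[< P x >]) s); split.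
  exact: List.NoDup_filter.
move=> x; rewrite List.filter_In; split=> -[xs Px]; split=> //; first exact/asboolP.
exact/asboolP.
Qed.

Lemma places_over_seq K (P : seq nat) : number_field K -> all prime P ->
  exists ws, List.NoDup ws /\
    forall w, List.In w ws <-> is_place K w /\ prime_below K w \in P.
Proof.
move=> nK; have sK := nK.1; elim: P => [|p P IH] /=.
  by exists [::]; split=> [|w]; [constructor | split=> [[]|[_]]].
move=> /andP[pr_p /IH[ws [_ wsP]]]; have [ws' [_ ws'P]] := places_over nK pr_p.
have [r [ur rP]] := nodup_exists (ws' ++ ws).
exists r; split=> // w; rewrite rP List.in_app_iff wsP ws'P inE; split.
  case=> [pw|[plw wP]]; last by rewrite wP orbT.
  by rewrite (prime_belowE sK pw) eqxx; split=> //; exists p.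
case=> [plw /orP[/eqP Dp|wP]]; last by right.
by left; rewrite -Dp; apply: is_place_prime.
Qed.

Lemma unit_outside x : x != 0 -> exists2 M, (0 < M)%N &
  forall K p v, is_subfield K -> is_place_over K p v -> K x -> ~~ (p %| M)%N -> v x = 1.
Proof.
move=> nz_x; suff le1 y : exists2 M, (0 < M)%N & forall K p v, is_subfield K ->
    is_place_over K p v -> K y -> ~~ (p %| M)%N -> v y <= 1.
  have [[M M_gt0 MP] [M' M'_gt0 M'P]] := (le1 x, le1 x^-1).
  exists (M * M')%N => [|K p v sK pv Kx]; first by rewrite muln_gt0 M_gt0.
  rewrite Euclid_dvdM ?(place_primeP pv) // negb_or => /andP[pM pM'].
  apply/eqP; rewrite eq_le (MP K p) //=.
  have := M'P K p v sK pv (subfieldV sK Kx) pM'.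
  by rewrite (placeV sK pv) // invf_le1 // (place_gt0 pv).
have [q [Dq mon_q] _] := minCpolyP y.
exists (\prod_(i < size q) `|denq q`_i|)%N.
  by rewrite prodn_gt0 // => i; rewrite absz_gt0 denq_neq0.
move=> K p v sK pv Ky pM;
apply: (place_monic_root sK pv (minCpoly_monic y) _ _ Ky (root_minCpoly y)) => i;
  rewrite Dq coef_map /=; first exact: subfield_ratr.
have [lt_i|ge_i] := ltnP i (size q); last by rewrite nth_default // rmorph0 (place0 sK pv) ler01.
have cop : coprime p `|denq q`_i|.
  rewrite prime_coprime ?(place_primeP pv) //; apply: contra pM => p_dv.
  by rewrite (bigD1 (Ordinal lt_i)) //= dvdn_mulr.
have Kz := subfield_int sK.
rewrite /ratr (placeM pv) ?(placeV sK pv) ?(subfieldV sK) //.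
rewrite -[denq _]gez0_abs ?denq_ge0 // (place_coprime sK pv cop) invr1 mulr1.
exact: (place_int sK pv).
Qed.

Lemma covers_support_exists K x (P : seq nat) : number_field K -> K x -> x != 0 ->
  exists vs, covers_support K x vs /\
    forall v, is_place K v -> prime_below K v \in P -> List.In v vs.
Proof.
move=> nK Kx nz_x; have sK := nK.1; have [M M_gt0 MP] := unit_outside nz_x.
have [|vs [uvs vsP]] := @places_over_seq K (filter prime P ++ primes M) nK.
  by rewrite all_cat filter_all all_prime_primes.
exists vs; split; first split=> // v; first by case/vsP.
  move=> plv vx; apply/vsP; split=> //; rewrite mem_cat orbC mem_primes M_gt0 /=.
  have pv := is_place_prime sK plv; rewrite (place_primeP pv) /=.
  apply/orP; left; apply: contraT => pM.
  by rewrite (MP K _ v sK pv Kx pM) eqxx in vx.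
move=> v plv vP; apply/vsP; split=> //; rewrite mem_cat mem_filter vP andbT.
by rewrite (place_primeP (is_place_prime sK plv)).
Qed.

(** * The functionals in C^* *)

Lemma finite_index_stab_of_fixing Phi th :
  (forall h : Gal, h th = th -> in_Stab Phi h) -> finite_index_stab Phi.
Proof.
move=> fix_th; pose eta := primitive_elt (conjs th).
exists [seq aut eta t | t <- conjs eta] => s; pose tau := aut eta (s eta).
have Dtau : tau eta = s eta by rewrite autE ?conjs_aut.
exists tau; split; first by apply/In_map_mem; exists (s eta); rewrite ?conjs_aut.
exists (s \o algC_invaut tau : Gal); split=> [|x]; last by rewrite /= algC_autK.
apply: fix_th; have : th \in map tau (conjs th) by rewrite (perm_mem (perm_conjs_aut _ _)) conjs_id.
case/mapP=> c cth Dth; rewrite /= {1}Dth algC_autK [RHS]Dth; apply: aut_eq_Qadjoin (esym Dtau).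
exact: Qadjoin_primitive.
Qed.

Lemma fixing_of_finite_index_stab Phi : finite_index_stab Phi ->
  exists th, forall h : Gal, h th = th -> in_Stab Phi h.
Proof.
case=> taus tausP.
suff [xs xsP] : exists xs : seq algC, forall tau : Gal, List.In tau taus ->
    {in xs, forall x, Phi (tau x) = Phi x} -> in_Stab Phi tau.
  exists (primitive_elt xs) => s fs x; have [tau [tau_in [h [hS Ds]]]] := tausP s.
  rewrite Ds hS; apply: (xsP tau) => // y /Qadjoin_primitive yxs.
  by rewrite -hS -Ds (aut_eq_Qadjoin (t := idfun) yxs).
elim: taus {tausP} => [|tau taus [xs xsP]]; first by exists [::].
have [tauS|/existsNP[x nx]] := pselect (in_Stab Phi tau).
  by exists xs => u /= [<- //|]; apply: xsP.
exists (x :: xs) => u /= [<- /(_ x (mem_head _ _)) //|u_in ux].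
by apply: (xsP u u_in) => y yxs; apply: ux; rewrite inE yxs orbT.
Qed.

Lemma big_In_eq (R : nmodType) (T : Type) (r s : seq T) (F : T -> R) :
  List.NoDup r -> List.NoDup s -> (forall x, List.In x r <-> List.In x s) ->
  \sum_(x <- r) F x = \sum_(x <- s) F x.
Proof.
move=> ur us rs; have pm := Permutation.NoDup_Permutation ur us rs.
elim: pm => {r s ur us rs} // [x r s _ IH|x y r|r s t _ -> _ ->//].
  by rewrite !big_cons IH.
by rewrite !big_cons addrCA.
Qed.

Lemma sum_indicator (R : pzRingType) (T : Type) (u : T) (s : seq T) (g : T -> R) :
  List.NoDup s ->
  \sum_(x <- s) `[< u = x >]%:R * g x = `[< List.In u s >]%:R * g u.
Proof.
elim: s => [|a s IH] us.
  by rewrite big_nil asboolF ?mul0r //.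
have [a_s us'] := (List.NoDup_cons_iff a s).1 us.
rewrite big_cons IH //; have [ua|nua] := pselect (u = a).
  by rewrite ua (asboolT (erefl a)) (asboolF a_s) mul0r addr0 asboolT //=; left.
rewrite (asboolF nua) mul0r add0r; congr ((nat_of_bool _)%:R * _); apply: asbool_equiv_eq => /=.
by split=> [|[/esym|]] //; right.
Qed.

Lemma eq_in_big_list (R : nmodType) (T : Type) (s : seq T) (F G : T -> R) :
  (forall x, List.In x s -> F x = G x) -> \sum_(x <- s) F x = \sum_(x <- s) G x.
Proof.
elim: s => [|a s IH] FG; first by rewrite !big_nil.
by rewrite !big_cons FG ?IH //=; [move=> x xs; apply: FG; right | left].
Qed.

Lemma Aunit_aut (s : Gal) u : Aunit u -> Aunit (s u).
Proof.
case=> Au [Aiu nz_u]; split; first by rewrite Aint_aut.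
by split; [rewrite -fmorphV Aint_aut | rewrite fmorph_eq0].
Qed.

Definition primitive_of (K : pred algC) : algC :=
  ClassicalEpsilon.epsilon (inhabits 0)
    (fun th => K th /\ forall x, K x -> Qadjoin th x).

Lemma primitive_ofP K : number_field K ->
  K (primitive_of K) /\ forall x, K x -> Qadjoin (primitive_of K) x.
Proof.
move=> /number_field_primitive[th Kth gen].
apply: (ClassicalEpsilon.epsilon_spec (inhabits 0)
  (fun th => K th /\ forall x, K x -> Qadjoin th x)).
by exists th.
Qed.

(* Over K = Q(th), the elements atom p th t span the functionals
   x |-> sum of l_s * lam p (s x), with s ranging over the embeddings of K. *)
Definition atom (p : nat) (th t x : algC) : rat :=
  mean (primitive_elt [:: th; x]) (fun s => (s th == t)%:R * lam p (s x)).

Section Atom.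
Variables (p : nat) (pr_p : prime p) (th t : algC).

Lemma atom_determined x eta : Qadjoin eta th -> Qadjoin eta x ->
  determined (fun s : Gal => (s th == t)%:R * lam p (s x) : rat) eta.
Proof.
move=> eth ex s u su.
by rewrite (aut_eq_Qadjoin eth su) (aut_eq_Qadjoin ex su).
Qed.

Lemma atomE x eta : Qadjoin eta th -> Qadjoin eta x ->
  atom p th t x = mean eta (fun s => (s th == t)%:R * lam p (s x)).
Proof.
move=> eth ex; apply: mean_indep; apply: atom_determined => //;
  by apply: Qadjoin_primitive; rewrite !inE eqxx ?orbT.
Qed.

Lemma atom_Qadjoin x : t \in conjs th -> Qadjoin th x ->
  (size (conjs th))%:R * atom p th t x = lam p (aut th t x).
Proof.
move=> tth thx; rewrite (atomE (Qadjoin_id th) thx) /mean mulrC divfK; last first.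
  by rewrite pnatr_eq0 -lt0n conjs_size_gt0.
rewrite (bigD1_seq t) ?conjs_uniq //= autE // eqxx mul1r big1_seq ?addr0 //.
by move=> u /andP[ut uth]; rewrite autE // (negPf ut) mul0r.
Qed.

Lemma atom_Sdual : Sdual (atom p th t).
Proof.
split=> [|x y nx ny|u Au].
- rewrite /atom -[RHS](mean0 _ (primitive_elt [:: th; 0])); apply: eq_mean => s.
  by rewrite rmorph0 lam0 // mulr0.
- pose eta := primitive_elt [:: th; x; y].
  have [eth ex ey] : [/\ Qadjoin eta th, Qadjoin eta x & Qadjoin eta y].
    by split; apply: Qadjoin_primitive; rewrite !inE eqxx ?orbT.
  rewrite !(@atomE _ eta) //; last exact: QadjoinM.
  rewrite -meanD; apply: eq_mean => s.
  by rewrite rmorphM lamM ?fmorph_eq0 // mulrDr.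
- rewrite /atom -[RHS](mean0 _ (primitive_elt [:: th; u])); apply: eq_mean => s.
  by rewrite lam_Aunit ?mulr0 //; apply: Aunit_aut.
Qed.

Lemma atom_stab (h : Gal) : h th = th -> in_Stab (atom p th t) h.
Proof.
move=> hth x; pose eta := primitive_elt [:: th; x].
have [eth ex] : Qadjoin eta th /\ Qadjoin eta x.
  by split; apply: Qadjoin_primitive; rewrite !inE eqxx ?orbT.
have hQ y : Qadjoin eta y -> Qadjoin (h eta) (h y).
  by case=> q ->; exists q; rewrite aut_horner.
rewrite (atomE eth ex) -(mean_comp h (atom_determined eth ex)).
have heth : Qadjoin (h eta) th by have := hQ th eth; rewrite hth.
rewrite (atomE heth (hQ x ex)).
by apply: eq_mean => s /=; rewrite hth.
Qed.

Definition atom_c (K : pred algC) (v : algC -> RR) : rat :=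
  mean (primitive_elt [:: primitive_of K; th])
    (fun s => (s th == t)%:R * `[< place K p s = v >]%:R).

Lemma atom_c_determined K v eta : number_field K -> Qadjoin eta (primitive_of K) ->
  Qadjoin eta th ->
  determined (fun s : Gal => (s th == t)%:R * `[< place K p s = v >]%:R : rat) eta.
Proof.
move=> nK eK eth s u su; have [_ gen] := primitive_ofP nK.
rewrite (aut_eq_Qadjoin eth su); congr (_ * _%:R).
by rewrite (place_Qadjoin_eq p gen (aut_eq_Qadjoin eK su)).
Qed.

Lemma atom_cE K v eta : number_field K -> Qadjoin eta (primitive_of K) ->
  Qadjoin eta th ->
  atom_c K v = mean eta (fun s => (s th == t)%:R * `[< place K p s = v >]%:R).
Proof.
move=> nK eK eth; apply: mean_indep; apply: atom_c_determined => //;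
  by apply: Qadjoin_primitive; rewrite !inE eqxx ?orbT.
Qed.

Lemma place_above_place K L (s : Gal) v : {subset K <= L} ->
  (forall x, ~~ K x -> v x = 0) ->
  place_above K v (place L p s) <-> place K p s = v.
Proof.
move=> KL v0; have {}KL x : K x -> L x by apply: KL.
split=> [ab|<- x Kx]; last by rewrite /place Kx KL.
apply/funext => x; rewrite /place; case: ifPn => [Kx|/v0 -> //].
by rewrite -ab // /place KL.
Qed.

Lemma atom_c_consistent : consistent atom_c.
Proof.
move=> K L v nK nL KL [q qv]; have [sK sL] := (nK.1, nL.1).
have [ws [uws wsP]] := places_over nL (place_primeP qv).
have [r [ur rP]] := filter_exists (place_above K v) uws.
exists r; split=> // [w|].
  rewrite rP wsP; split=> -[wL ab]; split=> //; first by exists q.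
  case: wL => q' q'w; suff -> : q = q' by [].
  apply/eqP; apply: contraT => nq; have pr_q := place_primeP qv.
  have := place_p_lt1 qv; rewrite -ab; last exact: subfield_nat.
  rewrite (place_coprime sL q'w) ?ltxx // prime_coprime ?(place_primeP q'w) //.
  by rewrite dvdn_prime2 ?(place_primeP q'w) // eq_sym.
pose eta := primitive_elt [:: primitive_of L; th].
have [eL eth] : Qadjoin eta (primitive_of L) /\ Qadjoin eta th.
  by split; apply: Qadjoin_primitive; rewrite !inE eqxx ?orbT.
have eK : Qadjoin eta (primitive_of K).
  apply: Qadjoin_trans eL _; have [_ gen] := primitive_ofP nL.
  by apply: gen; apply: KL; have [] := primitive_ofP nK.
rewrite (atom_cE _ nK eK eth).
under eq_bigr do rewrite (atom_cE _ nL eL eth).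
rewrite -mean_sum; apply: eq_mean => s.
rewrite -mulr_sumr; congr (_ * _).
under eq_bigr do rewrite -[_%:R]mulr1.
rewrite sum_indicator // mulr1; congr ((nat_of_bool _)%:R); apply: asbool_equiv_eq.
rewrite rP wsP (place_above_place s KL (place_outside qv)).
split=> [e|[]//]; split=> //; have -> : q = p; last exact: place_is_place.
by apply: (place_over_inj sK qv); rewrite -e; apply: place_is_place.
Qed.

Lemma atom_is_Phi_c : is_Phi_c atom_c (atom p th t).
Proof.
move=> x K n y vs nz_x nK [n_gt0 Ky nz_y [u [Au Dxn]]] [uvs vsP cov].
have sK := nK.1.
pose eta := primitive_elt [:: primitive_of K; th; x].
have [eK eth ex] : [/\ Qadjoin eta (primitive_of K), Qadjoin eta th & Qadjoin eta x].
  by split; apply: Qadjoin_primitive; rewrite !inE eqxx ?orbT.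
rewrite (atomE eth ex) ratr_mean.
under eq_bigr do rewrite (atom_cE _ nK eK eth) ratr_mean -mulrA mulrC -meanZ.
rewrite -mean_sum; apply: eq_mean => s.
under eq_bigr do rewrite rmorphM mulrCA.
rewrite rmorphM -mulr_sumr; congr (_ * _).
have nR : n%:R != 0 :> RR by rewrite pnatr_eq0 -lt0n.
have nz_sy : s y != 0 by rewrite fmorph_eq0.
have lamx : ratr (lam p (s x)) = ratr (lam p (s y)) / n%:R :> RR.
  have Dl : lam p (s x) *+ n = lam p (s y).
    rewrite -lamX ?fmorph_eq0 // -rmorphXn Dxn rmorphM lamM ?fmorph_eq0 //.
      by rewrite (lam_Aunit pr_p (Aunit_aut s Au)) addr0.
    by case: Au => _ [].
  by rewrite -Dl rmorphMn -mulr_natr mulfK.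
under eq_bigr do rewrite mulrC rmorph_nat.
rewrite sum_indicator // /log_vnorm.
have pp := place_is_place s sK pr_p.
rewrite (prime_belowE sK pp) /= lamx /place Ky.
case: asboolP => [_|nin].
  rewrite mul1r rlog_wabs // mulrA; congr (_ / _).
  by rewrite mulrCA mulVf ?mulr1 // gt_eqF // rlog_prime_gt0.
rewrite mul0r; suff -> : lam p (s y) = 0 by rewrite rmorph0 mul0r.
have : place K p s y = 1.
  apply/eqP; apply: contraT => ny; case: nin; apply: cov => //; by exists p.
rewrite /place Ky => /(congr1 rlog); rewrite rlog_wabs // rlog1 => /eqP.
by rewrite mulf_eq0 fmorph_eq0 (gt_eqF (rlog_prime_gt0 pr_p)) orbF => /eqP.
Qed.

Lemma atom_c_supported : supported_on atom_c [:: p].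
Proof.
move=> K v nK plv; rewrite inE => np.
rewrite /atom_c -[RHS](mean0 _ (primitive_elt [:: primitive_of K; th])).
apply: eq_mean => s; rewrite asboolF ?mulr0 // => /(place_primeE nK.1 pr_p) e.
by rewrite e eqxx in np.
Qed.

Lemma atom_Cstar : Cstar (atom p th t).
Proof.
have dual := atom_Sdual; split; split=> //.
  exact: finite_index_stab_of_fixing atom_stab.
exists atom_c; split; [exact: atom_c_consistent | exact: atom_is_Phi_c |].
by exists [:: p]; apply: atom_c_supported.
Qed.
End Atom.

Lemma CstarZ q Phi : Cstar Phi -> Cstar (fun x => q * Phi x).
Proof.
case=> -[[P0 PM PU] [taus tausP]] [_ [c [cons cPhi [S cS]]]].
have dual : Sdual (fun x => q * Phi x).
  split=> [|x y nx ny|u Au]; first by rewrite P0 mulr0.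
    by rewrite PM // mulrDr.
  by rewrite PU // mulr0.
split; split=> //.
  exists taus => s; have [tau [tin [h [hS Ds]]]] := tausP s; exists tau; split=> //.
  by exists h; split=> // x; rewrite hS.
exists (fun K v => q * c K v); split.
- move=> K L v nK nL KL pv; have [ws [u wsP Dc]] := cons K L v nK nL KL pv.
  by exists ws; split=> //; rewrite Dc mulr_sumr.
- move=> x K n y vs nx nK xy cov; rewrite rmorphM /= (cPhi x K n y vs) // mulr_sumr.
  by apply: eq_bigr => v _; rewrite rmorphM !mulrA.
- by exists S => K v nK pv vS; rewrite (cS K v) ?mulr0.
Qed.

Lemma CstarD Phi Psi : Cstar Phi -> Cstar Psi -> Cstar (fun x => Phi x + Psi x).
Proof.
case=> -[[P0 PM PU] fiP] [_ [c [cons cPhi [S cS]]]].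
case=> -[[Q0 QM QU] fiQ] [_ [d [dons dPsi [T dT]]]].
have dual : Sdual (fun x => Phi x + Psi x).
  split=> [|x y nx ny|u Au]; first by rewrite P0 Q0 addr0.
    by rewrite PM // QM // addrACA.
  by rewrite PU // QU // addr0.
split; split=> //.
  have [th thP] := fixing_of_finite_index_stab fiP.
  have [eta etaP] := fixing_of_finite_index_stab fiQ.
  apply: (@finite_index_stab_of_fixing _ (primitive_elt [:: th; eta])) => h hfix x.
  have fixes y : y \in [:: th; eta] -> h y = y.
    by move=> /Qadjoin_primitive yQ; apply: (aut_eq_Qadjoin (t := idfun) yQ).
  by rewrite (thP h) ?(etaP h) // fixes // !inE eqxx ?orbT.
exists (fun K v => c K v + d K v); split.
- move=> K L v nK nL KL pv; have [ws [u wsP Dc]] := cons K L v nK nL KL pv.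
  have [ws' [u' ws'P Dd]] := dons K L v nK nL KL pv.
  exists ws; split=> //; rewrite big_split Dc Dd; congr (_ + _).
  by apply: big_In_eq => // w; rewrite wsP ws'P.
- move=> x K n y vs nx nK xy cov.
  rewrite rmorphD /= (cPhi x K n y vs) // (dPsi x K n y vs) // -big_split.
  by apply: eq_bigr => v _; rewrite rmorphD !mulrDl.
- exists (S ++ T) => K v nK pv; rewrite mem_cat negb_or => /andP[vS vT].
  by rewrite (cS K v) ?(dT K v) ?addr0.
Qed.

Lemma Cstar0 : Cstar (fun=> 0).
Proof.
have := CstarZ 0 (atom_Cstar (isT : prime 2) 0 0).
by congr Cstar; apply/funext => x; rewrite mul0r.
Qed.

Lemma Cstar_sum (I : Type) (r : seq I) (F : I -> algC -> rat) :
  (forall i, Cstar (F i)) -> Cstar (fun x => \sum_(i <- r) F i x).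
Proof.
move=> FC; elim: r => [|i r IH].
  by have := Cstar0; congr Cstar; apply/funext => x; rewrite big_nil.
by have := CstarD (FC i) IH; congr Cstar; apply/funext => x; rewrite big_cons.
Qed.

Definition Qfield (th : algC) : pred algC := fun x => `[< Qadjoin th x >].

Lemma QfieldP th x : reflect (Qadjoin th x) (Qfield th x).
Proof. exact: asboolP. Qed.

Lemma Qfield_subfield th : is_subfield (Qfield th).
Proof.
split=> [|x y /QfieldP Qx /QfieldP Qy|x y /QfieldP Qx /QfieldP Qy|x /QfieldP Qx];
  apply/QfieldP; [exact: Qadjoin1|exact: QadjoinB|exact: QadjoinM|exact: QadjoinV].
Qed.

Lemma rat_comb_powers th (q : seq rat) n :
  rat_comb q [seq th ^+ i | i <- iota 0 n] = \sum_(i < n) QtoC q`_i * th ^+ i.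
Proof.
rewrite /rat_comb size_map size_iota; apply: eq_bigr => i _.
by rewrite (nth_map 0%N) ?size_iota // nth_iota // add0n.
Qed.

Lemma Qadjoin_powers th x : Qadjoin th x ->
  exists q : {poly rat}, x = \sum_(i < size (conjs th)) QtoC q`_i * th ^+ i.
Proof.
case=> q ->; have [m [Dm mon_m] dv_m] := minCpolyP th.
have sz_m : size m = (size (conjs th)).+1.
  by rewrite -size_minCpoly_conjs Dm size_map_poly.
exists (q %% m); rewrite {1}(divp_eq q m) rmorphD rmorphM hornerD hornerM.
have /rootP -> : root (pQtoC m) th by rewrite dv_m.
rewrite mulr0 add0r (horner_unbounded _ (n := size (conjs th))); last first.
  by rewrite size_map_poly -ltnS -sz_m ltn_modp monic_neq0.
by apply: eq_bigr => i _; rewrite coef_map.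
Qed.

Lemma Qfield_number_field th : number_field (Qfield th).
Proof.
split; first exact: Qfield_subfield.
exists [seq th ^+ i | i <- iota 0 (size (conjs th))]; split.
- by apply/allP => _ /mapP[i _ ->]; apply/QfieldP/QadjoinX/Qadjoin_id.
- by move=> x /QfieldP/Qadjoin_powers[q ->]; exists q; rewrite rat_comb_powers.
- move=> q; rewrite size_map size_iota rat_comb_powers => sz_q q0 i lt_i.
  have [m [Dm mon_m] dv_m] := minCpolyP th.
  have sz_m : size m = (size (conjs th)).+1.
    by rewrite -size_minCpoly_conjs Dm size_map_poly.
  have sz_P : (size (Poly q) <= size (conjs th))%N by rewrite -sz_q size_Poly.
  have : root (pQtoC (Poly q)) th.
    rewrite /root (horner_unbounded _ (n := size (conjs th))) ?size_map_poly // -[X in _ == X]q0.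
    by apply/eqP; apply: eq_bigr => j _; rewrite coef_map coef_Poly.
  rewrite dv_m; have [P0 _|nP /dvdp_leq-/(_ nP)] := eqVneq (Poly q) 0.
    by rewrite -coef_Poly P0 coef0.
  by rewrite sz_m leqNgt ltnS sz_P.
Qed.

Lemma Sdual_prod Phi (I : Type) (r : seq I) (P : pred I) (F : I -> algC) : Sdual Phi ->
  (forall i, F i != 0) ->
  Phi (\prod_(i <- r | P i) F i) = \sum_(i <- r | P i) Phi (F i).
Proof.
case=> _ PM PU nzF; elim: r => [|i r IH].
  by rewrite !big_nil PU //; split; rewrite ?invr1 ?Aint1 ?oner_neq0.
rewrite !big_cons; case: ifP => // _; rewrite PM ?IH //.
by elim: (r) => [|j s nz]; rewrite ?big_nil ?oner_neq0 // big_cons; case: ifP; rewrite ?mulf_neq0.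
Qed.

Lemma Sdual_norm th x : x != 0 -> exists2 N, Qadjoin th N /\ N != 0 &
  exists2 m, (0 < m)%N & forall Phi, Sdual Phi ->
    (forall h : Gal, h th = th -> in_Stab Phi h) -> Phi N = Phi x *+ m.
Proof.
move=> nz_x; pose eta := primitive_elt [:: th; x].
have [[q Dth] [g Dx]] : Qadjoin eta th /\ Qadjoin eta x.
  by split; apply: Qadjoin_primitive; rewrite !inE eqxx ?orbT.
pose P t := (pQtoC q).[t] == th.
exists (\prod_(t <- conjs eta | P t) (pQtoC g).[t]).
  split; last first.
    rewrite big_seq_cond prodf_seq_neq0; apply/allP => t; rewrite /= => _.
    apply/implyP => /andP[/conj_autP[s <-] _].
    by rewrite -aut_horner -Dx fmorph_eq0.
  apply: fixed_Qadjoin => h hth; rewrite rmorph_prod.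
  rewrite -[RHS](perm_big _ (perm_conjs_aut h eta)) big_map /=.
  apply: eq_big => [t|t _]; last by rewrite aut_horner.
  by rewrite /P -aut_horner -{2}hth (inj_eq (fmorph_inj h)).
exists (count P (conjs eta)).
  by rewrite -has_count; apply/hasP; exists eta; rewrite ?conjs_id // /P -Dth.
move=> Phi dP hP.
have gP t : t \in conjs eta -> P t -> (pQtoC g).[t] != 0 /\ Phi (pQtoC g).[t] = Phi x.
  move=> /conj_autP[s <-] /eqP; rewrite -!aut_horner -Dth -Dx fmorph_eq0 => sth.
  by split=> //; apply: hP.
pose F t := if (t \in conjs eta) && P t then (pQtoC g).[t] else 1.
have -> : \prod_(t <- conjs eta | P t) (pQtoC g).[t] = \prod_(t <- conjs eta | P t) F t.
  by rewrite big_seq_cond [RHS]big_seq_cond; apply: eq_bigr => t tP; rewrite /F tP.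
rewrite Sdual_prod //; last first.
  by move=> t; rewrite /F; case: ifP => [/andP[t1 t2]|_]; [case: (gP t t1 t2) | exact: oner_neq0].
rewrite big_seq_cond (eq_bigr (fun=> Phi x)) => [|t /[dup] tP /andP[t1 t2]]; last first.
  by rewrite /F tP; case: (gP t t1 t2).
by rewrite -big_seq_cond big_const_seq iter_addr_0.
Qed.

Lemma Sdual_eq_of_fixing Phi Psi th : Sdual Phi -> Sdual Psi ->
  (forall h : Gal, h th = th -> in_Stab Phi h) ->
  (forall h : Gal, h th = th -> in_Stab Psi h) ->
  (forall x, x != 0 -> Qadjoin th x -> Phi x = Psi x) -> Phi = Psi.
Proof.
move=> dP dQ hP hQ PQ; apply/funext => x; have [->|nz_x] := eqVneq x 0.
  by case: dP => -> _ _; case: dQ => ->.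
have [N [QN nz_N] [m m_gt0 NP]] := Sdual_norm th nz_x.
have := PQ N nz_N QN; rewrite !NP // => /eqP; rewrite eqrMn2r.
by rewrite -[m == _]negbK -lt0n m_gt0 => /eqP.
Qed.

Lemma big_In_sub (R : nmodType) (T : Type) (r s : seq T) (F : T -> R) :
  List.NoDup r -> List.NoDup s -> (forall x, List.In x s -> List.In x r) ->
  (forall x, List.In x r -> ~ List.In x s -> F x = 0) ->
  \sum_(x <- r) F x = \sum_(x <- s) F x.
Proof.
move=> ur us sr F0; have [r' [ur' r'P]] := filter_exists (fun x => List.In x s) ur.
transitivity (\sum_(x <- List.filter (fun x => `[< List.In x s >]) r) F x); last first.
  apply: big_In_eq => // [|x]; first exact: List.NoDup_filter.
  rewrite List.filter_In; split=> [[_ /asboolP]//|xs].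
  by split; [apply: sr | apply/asboolP].
elim: (r) F0 => [|a l IH] F0 /=; first by [].
rewrite big_cons IH => [|x xl]; last by apply: F0; right.
case: asboolP => [_|na]; first by rewrite big_cons.
by rewrite F0 ?add0r //; left.
Qed.

Lemma in_SK_id (K : pred algC) x : K x -> x != 0 -> in_SK K x 1 x.
Proof.
split=> //; exists 1; rewrite expr1 mulr1; split=> //.
by split; rewrite ?invr1 ?Aint1 ?oner_neq0.
Qed.

Lemma log_vnorm1 v x : log_vnorm v 1 x = rlog (v x).
Proof. by rewrite /log_vnorm divr1. Qed.

Definition atom_comb (l : seq (nat * algC * algC * rat)) (x : algC) : rat :=
  \sum_(e <- l) e.2 * atom e.1.1.1 e.1.1.2 e.1.2 x.

Lemma Cstar_atom_comb Phi : Cstar Phi ->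
  exists2 l, all (fun e => prime e.1.1.1) l & Phi = atom_comb l.
Proof.
case=> -[dP /fixing_of_finite_index_stab[th thP]] [_ [c [_ cPhi [P cP]]]].
pose K := Qfield th; have nK : number_field K := Qfield_number_field th.
have sK := nK.1; have Kth : K th by apply/QfieldP/Qadjoin_id.
have [|ws [uws wsP]] := @places_over_seq K (filter prime P) nK.
  exact: filter_all.
have /choice[sg sgP] v : exists s : Gal, is_place K v -> v = place K (prime_below K v) s.
  have [plv|nplv] := pselect (is_place K v); last by exists idfun.
  by have [s Ds] := place_conj nK (is_place_prime sK plv); exists s.
have ws_place v : List.In v ws -> is_place_over K (prime_below K v) v.
  by case/wsP => plv _; apply: is_place_prime.
pose l := [seq (prime_below K v, th, sg v th, (size (conjs th))%:R * c K v) | v <- ws].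
have all_l : all (fun e => prime e.1.1.1) l.
  rewrite all_map; elim: (ws) ws_place => [//|v r IH] wsp /=.
  rewrite (place_primeP (wsp v _)) ?IH //=; last by left.
  by move=> w wr; apply: wsp; right.
exists l => //.
have combC : Sdual (atom_comb l) /\ forall h : Gal, h th = th -> in_Stab (atom_comb l) h.
  rewrite /atom_comb; split.
    split=> [|x y nx ny|u Au].
    - rewrite big_seq big1 // => e /(allP all_l)/= pe.
      by have [-> _ _] := atom_Sdual pe e.1.1.2 e.1.2; rewrite mulr0.
    - rewrite -big_split /= !big_seq; apply: eq_bigr => e /(allP all_l)/= pe.
      by have [_ -> // _] := atom_Sdual pe e.1.1.2 e.1.2; rewrite mulrDr.
    - rewrite big_seq big1 // => e /(allP all_l)/= pe.
      by have [_ _ -> //] := atom_Sdual pe e.1.1.2 e.1.2; rewrite mulr0.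
  move=> h hth x; rewrite !big_map; apply: eq_in_big_list => v /ws_place pv /=.
  by rewrite atom_stab.
case: combC => dcomb hcomb; apply: (Sdual_eq_of_fixing dP dcomb thP hcomb) => x nz_x Qx.
have Kx : K x by apply/QfieldP.
have [vs [cov vsP]] := covers_support_exists P nK Kx nz_x.
apply: (fmorph_inj (ratr : rat -> RR)) => /=.
rewrite (cPhi x K 1%N x vs) //; last exact: in_SK_id.
have [uvs vs_place _] := cov.
rewrite (big_In_sub uvs uws).
- rewrite /atom_comb big_map rmorph_sum; apply: eq_in_big_list => v vws /=.
  have pv := ws_place v vws; have pr_p := place_primeP pv.
  have [plv _] := (wsP v).1 vws.
  rewrite log_vnorm1 [_%:R * _ * _]mulrAC atom_Qadjoin //; last exact: conjs_aut.
  have vx : v x = wabs (prime_below K v) (sg v x) by rewrite {1}(sgP v plv) /place Kx.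
  rewrite vx rlog_wabs ?fmorph_eq0 //.
  have -> : aut th (sg v th) x = sg v x by apply: aut_eq_Qadjoin Qx _; rewrite autE ?conjs_aut.
  by rewrite rmorphM /=; field; rewrite gt_eqF // rlog_prime_gt0.
- by move=> v /wsP[plv]; rewrite mem_filter => /andP[_ vP]; apply: vsP.
- move=> v /vs_place plv nws; rewrite (cP K v) // ?rmorph0 ?mul0r //.
  apply/negP => vP; apply: nws; apply/wsP; split=> //.
  by rewrite mem_filter vP andbT (place_primeP (is_place_prime sK plv)).
Qed.

(** * Local degrees and continuity *)

Lemma small_dependence (F : fieldType) (D N : nat) (M : nat -> nat -> F) : (N < D)%N ->
  exists2 a : nat -> F, (exists2 i, (i < D)%N & a i != 0) &
    forall j, (j < N)%N -> \sum_(i < D) a i * M i j = 0.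
Proof.
move=> lt_ND; pose A : 'M[F]_(D, N) := \matrix_(i, j) M i j.
have : kermx A != 0.
  by rewrite -mxrank_eq0 mxrank_ker subn_eq0 -ltnNge (leq_ltn_trans (rank_leq_col _)).
case/rowV0Pn=> u /sub_kermxP uA /eqP nz_u.
pose a i := oapp (u 0) 0 (insub i : option 'I_D).
have aE (i : 'I_D) : a i = u 0 i by rewrite /a valK.
exists a => [|j lt_j].
  apply: contrapT => no; apply: nz_u; apply/rowP => i; rewrite mxE -aE.
  by apply/eqP; apply: contraT => ai; case: no; exists i.
have /rowP/(_ (Ordinal lt_j)) := uA; rewrite !mxE; apply: etrans.
by apply: eq_bigr => i _; rewrite aE mxE.
Qed.

Lemma common_denominator (n : nat) (u : nat -> rat) :
  exists2 d : int, d != 0 & exists a : nat -> int,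
    forall i, (i < n)%N -> (a i)%:~R = d%:~R * u i.
Proof.
elim: n => [|n [d nz_d [a aP]]]; first by exists 1 => //; exists (fun=> 0).
exists (d * denq (u n)); first by rewrite mulf_neq0 ?denq_neq0.
exists (fun i => if i == n then d * numq (u n) else a i * denq (u n)) => i.
rewrite ltnS leq_eqVlt; case: eqP => [-> _|_ /= lt_i]; rewrite !rmorphM /=.
  by rewrite -mulrA numqE [u n * _]mulrC.
by rewrite aP // mulrAC.
Qed.

Section RamificationResidue.
Variables (z : algC) (p : nat) (v : algC -> RR).
Let K := Qfield z.
Let n := size (conjs z).
Hypothesis pv : is_place_over K p v.
Let sK : is_subfield K := Qfield_subfield z.
Let nK : number_field K := Qfield_number_field z.
Let pr_p : prime p := place_primeP pv.

Let nz_pC : p%:R != 0 :> algC. Proof. by rewrite pnatr_eq0 -lt0n prime_gt0. Qed.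

Lemma ram_index_exists : exists e, is_ram_index K v e.
Proof.
have [s Dv] := place_conj nK pv.
pose val x := - lam p (s x) * n`!%:R.
have val_int x : K x -> x != 0 -> exists j : int, val x = j%:~R.
  move=> /QfieldP Qx nz_x; have nz_sx : s x != 0 by rewrite fmorph_eq0.
  have [N /andP[N_gt0 N_le] NP] := lam_denom pr_p nz_sx.
  have /dvdnP[m Dm] : (N %| n`!)%N.
    rewrite dvdn_fact // N_gt0 (leq_trans N_le) //.
    have -> : size (conjs (s x)) = size (conjs x) by rewrite /conjs minCpoly_aut.
    exact: size_conjs_Qadjoin.
  apply/intrP; rewrite /val mulNr rpredN Dm natrM mulrCA.
  by rewrite rpredM ?natr_int // mulrC.
have valE x y (k : int) : K x -> K y -> x != 0 -> y != 0 -> val (x * y ^ k) = val x + k%:~R * val y.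
  move=> Kx Ky nx ny; rewrite /val rmorphM lamM ?fmorph_eq0 ?expfz_neq0 //.
  rewrite fmorphXz lamXz ?fmorph_eq0 // -mulrzl; ring.
have vE x y (k : int) : K x -> K y -> x != 0 -> y != 0 -> val x = k%:~R * val y -> v x = v y ^ k.
  move=> Kx Ky nx ny; rewrite /val !mulNr mulrN => /eqP; rewrite eqr_opp mulrA => /eqP.
  move/mulIf => E; rewrite Dv /place Kx Ky /wabs !fmorph_eq0 (negPf nx) (negPf ny).
  rewrite E ?pnatr_eq0 -?lt0n ?fact_gt0 // rmorphM /= ratr_int -mulrA.
  case: (k) => m; first by rewrite -exprnP rexpX -pmulrn mulr_natl.
  rewrite NegzE -exprnN; apply: (mulfI (_ : rexp (ratr (lam p (s y)) * rlog p%:R) ^+ m.+1 != 0)).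
    by rewrite expf_neq0 // gt_eqF ?rexp_gt0.
  rewrite divff ?expf_neq0 // ?gt_eqF ?rexp_gt0 // rexpX -rexpD rmorphN /= mulNr -pmulrn mulr_natl.
  by rewrite subrr rexp0.
have val_p : val p%:R = n`!%:R by rewrite /val rmorph_nat lam_prime // opprK mul1r.
have Kp : K p%:R by apply: subfield_nat.
pose P k := `[< (0 < k)%N /\ exists2 x, K x & x != 0 /\ val x = k%:R >].
have exP : exists k, P k.
  by exists n`!; apply/asboolP; split; [exact: fact_gt0 | exists p%:R].
case: (ex_minnP exP) => k0 /asboolP[k0_gt0 [pi Kpi [nz_pi val_pi]]] k0_min.
have gen x : K x -> x != 0 -> exists q : int, val x = q%:~R * val pi.
  move=> Kx nz_x; have [j Dj] := val_int x Kx nz_x; exists (j %/ k0)%Z.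
  have nz_k0 : k0%:Z != 0 by rewrite -lt0n.
  have Dr : val (x * pi ^ - (j %/ k0)%Z) = (j %% k0)%Z%:~R.
    rewrite valE // Dj {1}(divz_eq j k0) val_pi rmorphD rmorphM rmorphN /= mulNr.
    by rewrite addrAC subrr add0r.
  have r_ge0 := modz_ge0 j nz_k0.
  have r_lt : (j %% k0)%Z < k0 by rewrite ltz_pmod.
  have r0 : (j %% k0)%Z = 0.
    case Dr' : (j %% k0)%Z r_ge0 Dr => [[//|r]|] // _ Dr.
    have /k0_min : P r.+1.
      apply/asboolP; split=> //; exists (x * pi ^ - (j %/ k0)%Z) => //.
        apply: subfieldM => //; case: (- _) => m; rewrite ?NegzE -?exprnN -?exprnP.
          exact: subfieldX.
        by apply: subfieldV => //; apply: subfieldX.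
      by split; first by rewrite mulf_neq0 ?expfz_neq0.
    by rewrite leqNgt; move: r_lt; rewrite Dr' ltz_nat => ->.
  by rewrite Dj {1}(divz_eq j k0) r0 addr0 rmorphM /= val_pi.
have [q Dq] := gen _ Kp nz_pC.
have : 0 < q%:~R * k0%:R :> rat by rewrite -val_pi -Dq val_p ltr0n fact_gt0.
rewrite pmulr_lgt0 ?ltr0n // ltr0z; case: q Dq => // e Dq e_gt0.
exists e; split=> //; exists pi; split=> //; last first.
  by move=> x Kx nz_x; have [q Dx] := gen x Kx nz_x; exists q; apply: vE.
by rewrite (prime_belowE sK pv) -(place_p pv) exprnP; apply/esym/vE.
Qed.

Definition residue_free (f : nat) (b : nat -> algC) : Prop :=
  (forall i, (i < f)%N -> K (b i) /\ v (b i) <= 1) /\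
  forall a : nat -> int, v (\sum_(i < f) (a i)%:~R * b i) < 1 ->
    forall i, (i < f)%N -> (p %| a i)%Z.

Lemma residue_comb f b (a : nat -> int) : residue_free f b ->
  K (\sum_(i < f) (a i)%:~R * b i) /\ v (\sum_(i < f) (a i)%:~R * b i) <= 1.
Proof.
case=> bK _; have Kz := subfield_int sK.
have KF (i : 'I_f) : K ((a i)%:~R * b i) by apply: subfieldM => //; case: (bK i).
split; first exact: subfield_sum.
apply: (place_sum_le sK pv) => // i _; have [Kb vb] := bK i (ltn_ord i).
by rewrite (placeM pv) // mulr_ile1 ?(place_ge0 pv) ?(place_int sK pv).
Qed.

Lemma residue_free_le f b : residue_free f b -> (f <= n)%N.
Proof.
case=> bK bfree; rewrite leqNgt; apply/negP => lt_nf.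
have /choice[B BP] i : exists q : {poly rat}, (i < f)%N ->
    b i = \sum_(j < n) QtoC q`_j * z ^+ j.
  have [lt_i|ge_i] := ltnP i f; last by exists 0.
  by have [/QfieldP/Qadjoin_powers[q Dq] _] := bK i lt_i; exists q.
have [u [i0 lt_i0 ui0] uB] := small_dependence (fun i j => (B i)`_j) lt_nf.
have [d nz_d [a aP]] := common_denominator f u.
have sum0 : \sum_(i < f) (a i)%:~R * b i = 0.
  have -> : \sum_(i < f) (a i)%:~R * b i =
      \sum_(i < f) \sum_(j < n) QtoC (d%:~R * (u i * (B i)`_j)) * z ^+ j.
    apply: eq_bigr => i _; rewrite BP // mulr_sumr; apply: eq_bigr => j _.
    by rewrite mulrA -ratr_int aP // -rmorphM mulrA.
  rewrite exchange_big big1 // => j _; rewrite -mulr_suml -rmorph_sum -mulr_sumr uB //.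
  by rewrite mulr0 rmorph0 mul0r.
have pdiv k : forall c : nat -> int, \sum_(i < f) (c i)%:~R * b i = 0 ->
    forall i, (i < f)%N -> ((p ^ k)%N %| c i)%Z.
  elim: k => [|k IH] c c0 i lt_i; first by rewrite expn0 dvd1z.
  have pc j : (j < f)%N -> (p %| c j)%Z.
    by apply: bfree; rewrite c0 (place0 sK pv).
  pose c' j := (c j %/ p)%Z.
  have Dc j : (j < f)%N -> c j = c' j * p by move=> lt_j; rewrite /c' divzK ?pc.
  rewrite Dc // expnSr PoszM dvdz_mul //; apply: IH => //.
  apply: (mulfI nz_pC); rewrite mulr0 -[RHS]c0 mulr_sumr; apply: eq_bigr => j _.
  by rewrite Dc // rmorphM /= mulrA [p%:R * _]mulrC.
have a_neq0 : a i0 != 0.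
  by rewrite -(intr_eq0 rat) aP // mulf_neq0 // intr_eq0.
have := pdiv `|a i0|%N a sum0 i0 lt_i0.
rewrite dvdzE /= => /dvdn_leq; rewrite absz_gt0 => /(_ a_neq0).
by rewrite leqNgt ltn_expl // prime_gt1.
Qed.

Lemma residue_basis_exists : exists f b, residue_free f b /\
  forall x, K x -> v x <= 1 -> exists a : nat -> int,
    v (x - \sum_(i < f) (a i)%:~R * b i) < 1.
Proof.
have ex0 : exists f, `[< exists b, residue_free f b >].
  by exists 0%N; apply/asboolP; exists (fun=> 0); split.
have ub f : `[< exists b, residue_free f b >] -> (f <= n)%N.
  by move=> /asboolP[b /residue_free_le].
case: (ex_maxnP ex0 ub) => f /asboolP[b bf] fmax.
exists f, b; split=> // x Kx vx; apply: contrapT => /forallNP nx.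
suff /fmax : `[< exists b, residue_free f.+1 b >] by rewrite ltnn.
apply/asboolP; exists (fun i => if i == f then x else b i).
have [bK bfree] := bf; have Kz := subfield_int sK; split=> [i|a].
  by rewrite ltnS leq_eqVlt; case: eqP => //= _; apply: bK.
rewrite big_ord_recr /= eqxx.
under eq_bigr => i _ do rewrite ltn_eqF //.
set S := \sum_(i < f) _; have [KS vS] : K S /\ v S <= 1 by apply: residue_comb.
move=> lt1; have [p_af|p_af] := boolP (p %| a f)%Z.
  move=> i; rewrite ltnS leq_eqVlt => /orP[/eqP -> //|]; apply: bfree.
  rewrite -/S; have -> : S = (S + (a f)%:~R * x) - (a f)%:~R * x by rewrite addrK.
  have Kax : K ((a f)%:~R * x) by apply: subfieldM.
  apply: (placeD_lt pv) => //; [exact: subfieldD|exact: subfieldN|].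
  rewrite (placeN sK pv) // (placeM pv) //; case/dvdzP: p_af => m ->.
  rewrite rmorphM /= (placeM pv) //.
  rewrite mulrAC (le_lt_trans _ (place_p_lt1 pv)) //.
  by rewrite ler_piMl ?(place_ge0 pv) // mulr_ile1 ?(place_ge0 pv) ?(place_int sK pv).
have [c [d Dcd]] : exists c d : int, c * a f + d * p = 1.
  have : coprimez (a f) p by rewrite coprimez_sym coprimezE prime_coprime.
  by case/coprimezP => -[c d] /= <-; exists c, d.
case: (nx (fun i => - c * a i)).
have -> : \sum_(i < f) (- c * a i)%:~R * b i = - (c%:~R * S).
  by rewrite mulr_sumr -sumrN; apply: eq_bigr => i _; rewrite rmorphM rmorphN !mulNr mulrA.
have -> : x - - (c%:~R * S) = c%:~R * (S + (a f)%:~R * x) + p%:R * (d%:~R * x).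
  have E : c%:~R * (a f)%:~R + d%:~R * p%:R = 1 :> algC.
    by rewrite -[p%:R]/((Posz p)%:~R) -!rmorphM -rmorphD Dcd.
  transitivity (c%:~R * S + (c%:~R * (a f)%:~R + d%:~R * p%:R) * x); last by ring.
  by rewrite E mul1r opprK addrC.
have KSx : K (S + (a f)%:~R * x) by apply: subfieldD => //; apply: subfieldM.
have Kn := subfield_nat sK.
apply: (placeD_lt pv); [exact: subfieldM | by apply: subfieldM => //; apply: subfieldM | |].
  by rewrite (placeM pv) // (le_lt_trans _ lt1) // ler_piMl ?(place_ge0 pv) ?(place_int sK pv).
rewrite (placeM pv) //; last exact: subfieldM.
rewrite (le_lt_trans _ (place_p_lt1 pv)) // ler_piMr ?(place_ge0 pv) //.
by rewrite (placeM pv) // mulr_ile1 ?(place_ge0 pv) ?(place_int sK pv).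
Qed.

End RamificationResidue.

Section ResidueDegree.
Variables (z : algC) (p : nat) (v : algC -> RR).
Let K := Qfield z.
Hypothesis pv : is_place_over K p v.
Let sK : is_subfield K := Qfield_subfield z.
Let pr_p : prime p := place_primeP pv.

Variables (f : nat) (b : nat -> algC).
Hypothesis bf : residue_free z p v f b.
Hypothesis bgen : forall x, K x -> v x <= 1 -> exists a : nat -> int,
    v (x - \sum_(i < f) (a i)%:~R * b i) < 1.

Let comb (a : {ffun 'I_f -> 'I_p}) : algC := \sum_(i < f) (a i)%:R * b i.
Let ofun (a : 'I_f -> int) (i : nat) : int := oapp a 0 (insub i : option 'I_f).

Lemma ofunE a (i : 'I_f) : ofun a i = a i.
Proof. by rewrite /ofun valK. Qed.

Let sum_ofun (a : 'I_f -> int) :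
  \sum_(i < f) (ofun a i)%:~R * b i = \sum_(i < f) (a i)%:~R * b i.
Proof. by apply: eq_bigr => i _; rewrite ofunE. Qed.

Let comb_place a : K (comb a) /\ v (comb a) <= 1.
Proof. by have := residue_comb pv (ofun (fun i => (a i : nat)%:Z)) bf; rewrite sum_ofun. Qed.

Let comb_inj a a' : v (comb a - comb a') < 1 -> a = a'.
Proof.
have -> : comb a - comb a' =
    \sum_(i < f) (ofun (fun i => (a i : nat)%:Z - (a' i : nat)%:Z) i)%:~R * b i.
  rewrite sum_ofun -sumrB; apply: eq_bigr => i _.
  by rewrite rmorphB mulrBl.
case: bf => _ /[apply] H; apply/ffunP => i; apply: val_inj => /=.
have := H i (ltn_ord i); rewrite ofunE -eqz_mod_dvd !modz_nat eqz_nat.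
by rewrite !modn_small // => /eqP.
Qed.

Let comb_dist a a' : a != a' -> v (comb a - comb a') = 1.
Proof.
move=> naa'; have [[Ka va] [Ka' va']] := (comb_place a, comb_place a').
apply/eqP; rewrite eq_le (le_trans (placeB sK pv Ka Ka')) ?ge_max ?va //=.
by rewrite leNgt; apply/negP => /comb_inj/eqP; rewrite (negPf naa').
Qed.

Let comb_cover x : K x -> v x <= 1 -> exists a, v (x - comb a) < 1.
Proof.
move=> Kx vx; have [a va] := bgen Kx vx; have Kz := subfield_int sK.
have nz_p : p%:Z != 0 by rewrite -lt0n prime_gt0.
have lt_p i : (`|a i %% p|%Z < p)%N.
  by rewrite -ltz_nat gez0_abs ?modz_ge0 // ltz_pmod // ltz_nat prime_gt0.
pose a' := [ffun i : 'I_f => Ordinal (lt_p i)]; exists a'.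
have [Ka _] := residue_comb pv a bf.
have [Kq vq] := residue_comb pv (fun i => (a i %/ p)%Z) bf.
have -> : x - comb a' = (x - \sum_(i < f) (a i)%:~R * b i) +
    p%:R * \sum_(i < f) ((a i %/ p)%Z)%:~R * b i.
  rewrite -addrA; congr (_ + _); rewrite mulr_sumr -!sumrN -big_split.
  apply: eq_bigr => i _; rewrite ffunE /= {2}(divz_eq (a i) p).
  rewrite -[in RHS](gez0_abs (modz_ge0 (a i) nz_p)) rmorphD rmorphM /=.
  rewrite -[(Posz `|_|%N)%:~R]/(`|(a i %% p)%Z|%N%:R) -[(Posz p)%:~R]/(p%:R).
  ring.
apply: (placeD_lt pv) => //; first exact: subfieldB.
  by apply: subfieldM => //; apply: subfield_nat.
rewrite (placeM pv) //; last exact: subfield_nat.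
by rewrite (le_lt_trans _ (place_p_lt1 pv)) // ler_piMr ?(place_ge0 pv).
Qed.

Lemma residue_basis_is_res_degree : is_res_degree K v f.
Proof.
rewrite /is_res_degree (prime_belowE sK pv); exists [seq comb a | a <- enum {ffun 'I_f -> 'I_p}].
have sz : size [seq comb a | a <- enum {ffun 'I_f -> 'I_p}] = (p ^ f)%N.
  by rewrite size_map -cardE card_ffun !card_ord.
have a0 : {ffun 'I_f -> 'I_p} := [ffun=> Ordinal (prime_gt0 pr_p)].
split=> //.
- by apply/allP => _ /mapP[a _ ->]; case: (comb_place a).
- by apply/allP => _ /mapP[a _ ->]; case: (comb_place a).
- move=> i j; rewrite size_map => lt_i lt_j nij.
  by rewrite (nth_map a0 0 comb lt_i) (nth_map a0 0 comb lt_j) comb_dist // nth_uniq ?enum_uniq.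
- move=> x Kx vx; have [a va] := comb_cover Kx vx.
  exists (index a (enum {ffun 'I_f -> 'I_p})).
    by rewrite size_map index_mem mem_enum.
  by rewrite (nth_map a0) ?index_mem ?mem_enum // nth_index ?mem_enum.
Qed.

Lemma residue_basis_le f' : is_res_degree K v f' -> (f <= f')%N.
Proof.
rewrite /is_res_degree (prime_belowE sK pv) => -[s [sz sKs _ _ cov]].
have /choice[phi phiP] a : exists i : 'I_(p ^ f'), v (comb a - nth 0 s i) < 1.
  have [Ka va] := comb_place a; have [i lt_i vi] := cov _ Ka va.
  by rewrite sz in lt_i; exists (Ordinal lt_i).
have inj_phi : injective phi.
  move=> a a' e; apply: comb_inj.
  have Ks i : K (nth 0 s (i : 'I_(p ^ f'))) by apply: (allP sKs); rewrite mem_nth ?sz.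
  have [[Ka _] [Ka' _]] := (comb_place a, comb_place a').
  have -> : comb a - comb a' = (comb a - nth 0 s (phi a)) - (comb a' - nth 0 s (phi a)).
    by rewrite opprB addrA subrK.
  apply: (placeD_lt pv).
  - by apply: subfieldB => //; apply: Ks.
  - by apply: subfieldN => //; apply: subfieldB => //; apply: Ks.
  - exact: phiP.
  - by rewrite (placeN sK pv); [rewrite e; apply: phiP | apply: subfieldB => //; apply: Ks].
have := leq_card phi inj_phi; rewrite card_ffun !card_ord.
by rewrite (leq_exp2l _ _ (prime_gt1 pr_p)).
Qed.
End ResidueDegree.

Lemma lam_sum p (I : Type) (r : seq I) (F : I -> algC) c : prime p ->
  (forall i, F i != 0 -> lam p (F i) <= c) ->
  \sum_(i <- r) F i != 0 -> lam p (\sum_(i <- r) F i) <= c.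
Proof.
move=> pr_p Fc; elim: r => [|i r IH]; first by rewrite big_nil eqxx.
by rewrite big_cons; apply: (lam_Dle pr_p (Fc i) IH).
Qed.

Section Embeddings.
Variables (z : algC) (p : nat) (v : algC -> RR).
Let K := Qfield z.
Hypothesis pv : is_place_over K p v.
Let sK : is_subfield K := Qfield_subfield z.
Let pr_p : prime p := place_primeP pv.
Let nz_pC : p%:R != 0 :> algC. Proof. by rewrite pnatr_eq0 -lt0n prime_gt0. Qed.

(* The embeddings inducing v are linearly independent over algC; a relation
   among them holding on the products b_i pi^j would hold on all of K, since
   these products generate the valuation ring modulo every power of p. *)
Lemma count_embeddings_le :
  (count (fun t => `[< place K p (aut z t) = v >]) (conjs z) <= local_degree K v)%N.
Proof.
set T := filter (fun t => `[< place K p (aut z t) = v >]) (conjs z).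
rewrite -size_filter -/T.
have [e1 e1P] := ram_index_exists pv.
have [f [b [bf bgen]]] := residue_basis_exists pv.
have /(residue_basis_le pv bf) : is_res_degree K v (choose_nat (is_res_degree K v)).
  apply: ClassicalEpsilon.epsilon_spec; exists f.
  exact: (residue_basis_is_res_degree pv bf bgen).
have [e_gt0 [pi [Kpi nz_pi vpi gen]]] : is_ram_index K v (choose_nat (is_ram_index K v)).
  by apply: ClassicalEpsilon.epsilon_spec; exists e1.
rewrite /local_degree; set e := choose_nat _ in e_gt0 vpi *; set f1 := choose_nat _ => le_f.
apply: leq_trans (_ : e * f <= _)%N; last by rewrite leq_mul2l le_f orbT.
rewrite (prime_belowE sK pv) in vpi.
rewrite leqNgt; apply/negP => lt_T.
pose sg i := aut z (nth 0 T i).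
have TP i : (i < size T)%N -> nth 0 T i \in conjs z /\ place K p (sg i) = v.
  by move=> lt_i; have := mem_nth 0 lt_i; rewrite mem_filter => /andP[/asboolP].
pose beta k := b (k %% f)%N * pi ^+ (k %/ f).
have [a [i0 lt_i0 ai0] a_beta] := small_dependence (fun i k => sg i (beta k)) lt_T.
pose F x := \sum_(i < size T) a i * sg i x.
have FD x y : F (x + y) = F x + F y.
  by rewrite -big_split; apply: eq_bigr => i _; rewrite rmorphD mulrDr.
have FM (q : rat) x : F (QtoC q * x) = QtoC q * F x.
  by rewrite mulr_sumr; apply: eq_bigr => i _; rewrite rmorphM fmorph_rat mulrCA.
have F_beta i j : (i < f)%N -> (j < e)%N -> F (b i * pi ^+ j) = 0.
  move=> lt_i lt_j; have f_gt0 : (0 < f)%N by case: (f) lt_i.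
  have <- : beta (j * f + i)%N = b i * pi ^+ j.
    by rewrite /beta modnMDl modn_small // divnMDl // divn_small // addn0.
  apply: a_beta; rewrite (leq_trans (_ : _ < j.+1 * f)%N) ?leq_mul2r ?lt_j ?orbT //.
  by rewrite mulSn addnC ltn_add2r.
have vpi_gt0 : 0 < v pi by apply: (place_gt0 pv).
have vpi_lt1 : v pi < 1.
  rewrite ltNge; apply/negP => /(exprn_ege1 e); rewrite vpi -(place_p pv).
  by rewrite leNgt (place_p_lt1 pv).
have vpX m : v pi ^+ m <= 1 by apply: exprn_ile1; apply: ltW.
have approx x j : K x -> v x <= 1 -> (j <= e)%N ->
    exists y, [/\ K y, F y = F x & v y <= v pi ^+ j].
  move=> Kx vx; elim: j => [|j IH] le_j; first by exists x; rewrite expr0.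
  have [y [Ky Fy vy]] := IH (ltnW le_j).
  have Kpj : K (pi ^+ j) by apply: subfieldX.
  have vpj : v (pi ^+ j) = v pi ^+ j by rewrite (placeX sK pv).
  have Kyp : K (y / pi ^+ j) by apply: subfieldM => //; apply: subfieldV.
  have [|c vc] := bgen _ Kyp.
    rewrite (placeM pv) ?(placeV sK pv) ?(subfieldV sK) // vpj.
    by rewrite ler_pdivrMr ?exprn_gt0 // mul1r.
  have [KS _] := residue_comb pv c bf; set S := \sum_(i < f) _ in vc KS.
  have KD : K (y / pi ^+ j - S) by apply: subfieldB.
  have {}vc : v (y / pi ^+ j - S) <= v pi.
    have [->|nzD] := eqVneq (y / pi ^+ j - S) 0; first by rewrite (place0 sK pv) ltW.
    have [k Dk] := gen _ KD nzD; move: vc; rewrite Dk.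
    case: k {Dk} => [[|k]|k]; first by rewrite expr0z ltxx.
      by move=> _; rewrite -exprnP exprS ler_piMr // ltW.
    by rewrite NegzE -exprnN invf_lt1 ?exprn_gt0 // ltNge vpX.
  exists (y - S * pi ^+ j); split.
  - by apply: subfieldB => //; apply: subfieldM.
  - have FN u : F (- u) = - F u by rewrite -[- u]mulN1r -(rmorphN1 QtoC) FM rmorphN1 mulN1r.
    rewrite FD FN -[RHS]subr0 Fy; congr (_ - _).
    rewrite /S mulr_suml /F.
    under eq_bigr do rewrite rmorph_sum mulr_sumr.
    rewrite exchange_big big1 // => i _.
    transitivity (F ((c i)%:~R * (b i * pi ^+ j))).
      by apply: eq_bigr => i' _; rewrite mulrA.
    by rewrite -ratr_int FM F_beta ?mulr0.
  - have -> : y - S * pi ^+ j = (y / pi ^+ j - S) * pi ^+ j.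
      by rewrite mulrBl divfK // expf_neq0.
    by rewrite (placeM pv) // vpj exprS ler_pM2r // exprn_gt0.
have step x : K x -> v x <= 1 -> exists y, [/\ K y, v y <= 1 & F x = p%:R * F y].
  move=> Kx vx; have [y [Ky Fy vy]] := approx x e Kx vx (leqnn e).
  exists (p%:R^-1 * y); have Kp : K p%:R^-1 by apply: (subfieldV sK); apply: subfield_nat.
  have pE : p%:R = QtoC p%:R by rewrite ratr_nat.
  split; first exact: subfieldM.
    rewrite (placeM pv) // (placeV sK pv) ?subfield_nat //.
    rewrite ler_pdivrMl ?(place_gt0 pv) ?subfield_nat //.
    by rewrite mulr1 (place_p pv) -vpi.
  by rewrite pE -fmorphV FM mulrA -rmorphM divff ?rmorph1 ?mul1r ?Fy // pnatr_eq0 -lt0n prime_gt0.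
have [c cP] : exists c, forall i, (i < size T)%N -> a i != 0 -> lam p (a i) <= c.
  elim: (size T) => [|m [c cP]]; first by exists 0.
  exists (Num.max c (lam p (a m))) => i; rewrite ltnS leq_eqVlt => /orP[/eqP ->|lt_i] nz.
    by rewrite le_max lexx orbT.
  by rewrite le_max cP.
have lamF x : K x -> v x <= 1 -> F x != 0 -> lam p (F x) <= c.
  move=> Kx vx; apply: lam_sum => // i; rewrite mulf_eq0 => /norP[nza nzs].
  rewrite lamM // -[c]addr0 lerD ?cP //.
  have [_ Dv] := TP i (ltn_ord i); rewrite -(wabs_le1 _ pr_p).
  by move: vx; rewrite -Dv /place Kx.
have F0 x : K x -> v x <= 1 -> F x = 0.
  move=> Kx vx; apply/eqP; apply: contraT => nzF.
  have iter k : exists y, [/\ K y, v y <= 1 & F x = p%:R ^+ k * F y].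
    elim: k => [|k [y [Ky vy Fy]]]; first by exists x; rewrite expr0 mul1r.
    have [y' [Ky' vy' Fy']] := step y Ky vy; exists y'; split=> //.
    by rewrite Fy Fy' mulrA exprSr.
  pose k := Num.bound (c - lam p (F x)).
  have [y [Ky vy Fy]] := iter k.
  have nzFy : F y != 0 by apply: contra nzF => /eqP Fy0; rewrite Fy Fy0 mulr0.
  have k_gt : c - lam p (F x) < k%:R by apply: archi_boundP; rewrite subr_ge0 lamF.
  have := lamF y Ky vy nzFy; have := lamM pr_p (expf_neq0 k nz_pC) nzFy.
  rewrite -Fy lamX // lam_prime // mulNrn => E le_c.
  by move: k_gt; rewrite E; lra.
have F0X j : F (z ^+ j) = 0.
  have Kz : K (z ^+ j) by apply/QfieldP/QadjoinX/Qadjoin_id.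
  have [|m /(_ m (leqnn m)) mP] := @expr_small p%:R^-1 (v (z ^+ j)).
    by rewrite -(place_p pv) (place_ge0 pv) (place_p_lt1 pv).
  have Kpm : K (p%:R ^+ m) by rewrite -natrX; apply: subfield_nat.
  have : F (p%:R ^+ m * z ^+ j) = 0.
    apply: F0; first exact: subfieldM.
    by rewrite (placeM pv) // (placeX sK pv) ?subfield_nat // (place_p pv) ltW.
  rewrite -natrX -(ratr_nat algC) FM => /eqP; rewrite mulf_eq0 ratr_nat natrX.
  by rewrite (negPf (expf_neq0 m nz_pC)) => /eqP.
have Fpoly (q : {poly algC}) : \sum_(i < size T) a i * q.[nth 0 T i] = 0.
  under eq_bigr do rewrite horner_coef mulr_sumr.
  rewrite exchange_big big1 // => j _.
  under eq_bigr do rewrite mulrCA.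
  have E : \sum_(i < size T) a i * nth 0 T i ^+ j = F (z ^+ j).
    apply: eq_bigr => i _; rewrite rmorphXn /sg autE //.
    by case: (TP i (ltn_ord i)).
  by rewrite -mulr_sumr E F0X mulr0.
pose L := \prod_(t <- T | t != nth 0 T i0) ('X - t%:P).
have uT : uniq T by rewrite filter_uniq // conjs_uniq.
have := Fpoly L; rewrite (bigD1 (Ordinal lt_i0)) //= [X in _ + X]big1 => [|i ni].
  move/eqP; rewrite addr0 mulf_eq0 (negPf ai0) horner_prod prodf_seq_eq0 => /hasP[t _ /andP[nt]].
  by rewrite hornerXsubC subr_eq0 eq_sym (negPf nt).
rewrite horner_prod (big_rem (nth 0 T i)) ?mem_nth //= nth_uniq // ifT.
  by rewrite hornerXsubC subrr mul0r mulr0.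
by apply: contra ni => /eqP e'; apply/eqP/val_inj.
Qed.
End Embeddings.

Lemma degQ_bounds z : (0 < degQ (Qfield z) <= size (conjs z))%N.
Proof.
have [s [bs sz]] : exists s, is_Qbasis (Qfield z) s /\ size s = degQ (Qfield z).
  apply: (ClassicalEpsilon.epsilon_spec _
    (fun n => exists s, is_Qbasis (Qfield z) s /\ size s = n)).
  by have [_ [s bs]] := Qfield_number_field z; exists (size s), s.
have [sub spn free] := bs; rewrite -sz; apply/andP; split.
  have [q /eqP] := spn 1 (subfield1 (Qfield_subfield z)).
  by rewrite /rat_comb; case: (s) => //; rewrite big_ord0 oner_eq0.
rewrite leqNgt; apply/negP => lt_s.
have /choice[B BP] i : exists q : {poly rat}, (i < size s)%N ->
    nth 0 s i = \sum_(j < size (conjs z)) QtoC q`_j * z ^+ j.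
  have [lt_i|ge_i] := ltnP i (size s); last by exists 0.
  have /QfieldP/Qadjoin_powers[q Dq] : Qfield z (nth 0 s i).
    by apply: (allP sub); rewrite mem_nth.
  by exists q.
have [u [i lt_i ui] uB] := small_dependence (fun i j => (B i)`_j) lt_s.
case/eqP: ui; rewrite -(nth_mkseq 0 u lt_i); apply: free lt_i; first by rewrite size_mkseq.
rewrite /rat_comb.
have -> : \sum_(k < size s) QtoC (nth 0 (mkseq u (size s)) k) * nth 0 s k =
    \sum_(k < size s) \sum_(j < size (conjs z)) QtoC (u k * (B k)`_j) * z ^+ j.
  apply: eq_bigr => k _; rewrite nth_mkseq // BP // mulr_sumr.
  by apply: eq_bigr => j _; rewrite mulrA -rmorphM.
rewrite exchange_big big1 // => j _.
by rewrite -mulr_suml -rmorph_sum uB // rmorph0 mul0r.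
Qed.

Lemma ler_mean (R : numFieldType) th (F G : Gal -> R) :
  (forall s, F s <= G s) -> mean th F <= mean th G.
Proof.
move=> FG; rewrite /mean ler_wpM2r ?invr_ge0 ?ler0n //.
by apply: ler_sum => t _; apply: FG.
Qed.

Lemma normS_ge0 z r : z != 0 -> normS z r -> 0 <= r.
Proof.
move=> nz_z zr; have nK := Qfield_number_field z.
have Kz : Qfield z z by apply/QfieldP/Qadjoin_id.
have [vs [cov _]] := covers_support_exists [::] nK Kz nz_z.
by rewrite (zr _ _ _ _ nK (in_SK_id Kz nz_z) cov); apply: sumr_ge0.
Qed.

Lemma atom_le_normS p th t z r : prime p -> z != 0 -> normS z r ->
  `|ratr (atom p th t z) : RR| * rlog p%:R <= r.
Proof.
move=> pr_p nz_z zr; pose K := Qfield z; have nK : number_field K := Qfield_number_field z.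
have sK := nK.1; have Kz : K z by apply/QfieldP/Qadjoin_id.
have [vs [cov _]] := covers_support_exists [::] nK Kz nz_z.
rewrite (zr K 1%N z vs nK (in_SK_id Kz nz_z) cov); have [uvs vsP vsC] := cov.
have lp := rlog_prime_gt0 pr_p; set n := size (conjs z).
have n_gt0 : 0 < n%:R :> RR by rewrite ltr0n conjs_size_gt0.
have le_mean : `|atom p th t z| <= mean z (fun s => `|lam p (s z)|).
  set eta := primitive_elt [:: th; z].
  have ez : Qadjoin eta z by apply: Qadjoin_primitive; rewrite !inE eqxx orbT.
  have dz : determined (fun s : Gal => `|lam p (s z)|) z by move=> s u ->.
  rewrite -(mean_Qadjoin ez dz) (le_trans (normr_mean_le _ _)) //.
  apply: ler_mean => s; rewrite normrM; case: eqP => _; rewrite ?normr1 ?mul1r //.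
  by rewrite normr0 mul0r.
apply: le_trans (_ : ratr (mean z (fun s : Gal => `|lam p (s z)|)) * rlog p%:R <= _).
  by rewrite ler_pM2r // -ratr_norm ler_rat.
pose D v := count (fun u => `[< place K p (aut z u) = v >]) (conjs z).
have -> : ratr (mean z (fun s : Gal => `|lam p (s z)|)) * rlog p%:R =
    \sum_(v <- vs) (D v)%:R * `|rlog (v z)| / n%:R.
  rewrite -mulr_suml ratr_mean /mean mulrAC; congr (_ / _).
  transitivity (\sum_(u <- conjs z) \sum_(v <- vs)
      `[< place K p (aut z u) = v >]%:R * `|rlog (v z)|).
    rewrite mulr_suml; apply: eq_bigr => u _; rewrite sum_indicator //.
    have -> : ratr `|lam p (aut z u z)| * rlog p%:R = `|rlog (place K p (aut z u) z)|.
      rewrite /place Kz rlog_wabs ?fmorph_eq0 // normrM ratr_norm.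
      by rewrite (gtr0_norm lp).
    case: asboolP => [_|nin]; first by rewrite mul1r.
    rewrite mul0r; have -> : place K p (aut z u) z = 1; last by rewrite rlog1 normr0.
    apply/eqP; apply: contraT => ny; case: nin; apply: vsC => //.
    by exists p; apply: place_is_place.
  rewrite exchange_big; apply: eq_bigr => v _ /=; rewrite -mulr_suml; congr (_ * _).
  by rewrite -natr_sum /D -sum1_count [in RHS]big_mkcond.
apply: ler_sum => v _; rewrite log_vnorm1 normrM mulrAC ler_wpM2r ?normr_ge0 //.
have le_loc : (D v <= local_degree K v)%N.
  have [pv|npv] := pselect (is_place_over K p v); first exact: count_embeddings_le pv.
  rewrite (_ : D v = 0)%N //; apply/eqP; rewrite -leqn0 leqNgt -has_count.
  by apply/hasPn => u _; apply/asboolP => e; apply: npv; rewrite -e; apply: place_is_place.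
have /andP[deg_gt0 deg_le] := degQ_bounds z.
rewrite ger0_norm ?divr_ge0 ?ler0n // ler_pM ?invr_ge0 ?ler0n // ?ler_nat //.
by rewrite lef_pV2 ?posrE ?ltr0n ?ler_nat // conjs_size_gt0.
Qed.

Lemma Cstar_Sprime Phi : Cstar Phi -> Sprime Phi.
Proof.
move=> CPhi; have [[dPhi _] _] := CPhi; split=> //.
have [l pl DPhi] := Cstar_atom_comb CPhi.
have [C C_ge0 CP] : exists2 C : RR, 0 <= C & forall z r, z != 0 -> normS z r ->
    `|ratr (Phi z)| <= C * r.
  rewrite {}DPhi; elim: l pl => [_|e l IH /= /andP[pr_p /IH[C C_ge0 CP]]].
    by exists 0 => // z r _ _; rewrite /atom_comb big_nil rmorph0 normr0 mul0r.
  have lp := rlog_prime_gt0 pr_p.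
  exists (`|ratr e.2| / rlog e.1.1.1%:R + C).
    by rewrite addr_ge0 // divr_ge0 // ltW.
  move=> z r nz_z zr; rewrite /atom_comb big_cons rmorphD /= mulrDl.
  rewrite (le_trans (ler_normD _ _)) // lerD ?CP // rmorphM normrM -mulrA ler_wpM2l //.
  by rewrite ler_pdivlMl // mulrC; apply: atom_le_normS.
move=> x0 nz_x0 eps eps_gt0; have C1 : 0 < C + 1 by rewrite ltr_wpDl.
exists (eps / (C + 1)); first by rewrite divr_gt0.
move=> x r nz_x zr lt_r.
have nz_q : x / x0 != 0 by rewrite mulf_neq0 ?invr_eq0.
have -> : ratr (Phi x) - ratr (Phi x0) = ratr (Phi (x / x0)) :> RR.
  case: dPhi => _ PM _; rewrite -{1}[x](divfK nz_x0) PM // rmorphD /= addrK //.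
rewrite (le_lt_trans (CP _ _ nz_q zr)) //.
have r_ge0 := normS_ge0 nz_q zr.
rewrite (le_lt_trans (_ : _ <= (C + 1) * r)) ?ler_wpM2r ?lerDl //.
by rewrite mulrC -ltr_pdivlMr.
Qed.

Lemma linear_solve (F : fieldType) (m r : nat) (X : nat -> nat -> F) (b : nat -> F) :
  (forall u : nat -> F, (forall j, (j < r)%N -> \sum_(i < m) u i * X i j = 0) ->
     \sum_(i < m) u i * b i = 0) ->
  exists l : nat -> F, forall i, (i < m)%N -> \sum_(j < r) l j * X i j = b i.
Proof.
move=> ker; pose A : 'M[F]_(r, m) := \matrix_(j, i) X i j.
pose B : 'rV[F]_m := \row_i b i.
have : (B <= A)%MS.
  rewrite submxE; apply/eqP/rowP => k; rewrite !mxE.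
  pose u i := oapp (fun i : 'I_m => cokermx A i k) 0 (insub i : option 'I_m).
  have uE (i : 'I_m) : u i = cokermx A i k by rewrite /u valK.
  rewrite -[RHS](ker u) => [|j lt_j].
    by apply: eq_bigr => i _; rewrite uE !mxE mulrC.
  have /matrixP/(_ (Ordinal lt_j) k) := mulmx_coker A; rewrite !mxE; apply: etrans.
  by apply: eq_bigr => i _; rewrite uE !mxE mulrC.
case/submxP=> D DB; exists (fun j => oapp (D 0) 0 (insub j : option 'I_r)) => i lt_i.
have /rowP/(_ (Ordinal lt_i)) := DB; rewrite !mxE => ->.
by apply: eq_bigr => j _; rewrite valK /= !mxE.
Qed.

Lemma SdualXz Phi x (k : int) : Sdual Phi -> x != 0 -> Phi (x ^ k) = k%:~R * Phi x.
Proof.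
move=> dPhi nz_x; have [_ PM PU] := dPhi.
have P1 : Phi 1 = 0 by apply: PU; split; rewrite ?invr1 ?Aint1 ?oner_neq0.
have PX m : Phi (x ^+ m) = m%:R * Phi x.
  elim: m => [|m IH]; first by rewrite P1 mul0r.
  by rewrite exprS PM ?expf_neq0 // IH -[m.+1%:R]natr1 mulrDl mul1r addrC.
case: k => m; first exact: PX.
rewrite NegzE -exprnN rmorphN mulNr -[_ * _]/(m.+1%:R * Phi x) -PX.
apply/eqP; rewrite -addr_eq0 -PM ?invr_eq0 ?expf_neq0 //.
by rewrite mulVf ?expf_neq0 // P1.
Qed.

Lemma unit_outside_seq (xs : seq algC) : {in xs, forall x, x != 0} ->
  exists P : seq nat, all prime P /\ forall p (s : Gal), prime p -> p \notin P ->
    {in xs, forall x, lam p (s x) = 0}.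
Proof.
elim: xs => [|x xs IH] nz; first by exists [::].
have [|P [pP PP]] := IH; first by move=> y yxs; apply: nz; rewrite inE yxs orbT.
have nz_x : x != 0 by apply: nz; rewrite mem_head.
have [M M_gt0 MP] := unit_outside nz_x.
exists (primes M ++ P); split=> [|p s pr_p]; first by rewrite all_cat all_prime_primes.
rewrite mem_cat negb_or mem_primes pr_p M_gt0 /= => /andP[pM pP'] y.
rewrite inE => /orP[/eqP ->|yxs]; last exact: PP.
have pT := place_is_place s is_subfield_predT pr_p.
have := MP predT p _ is_subfield_predT pT isT pM.
rewrite /place => /(congr1 rlog); rewrite rlog_wabs ?fmorph_eq0 // rlog1 => /eqP.
by rewrite mulf_eq0 fmorph_eq0 (gt_eqF (rlog_prime_gt0 pr_p)) orbF => /eqP.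
Qed.

Lemma Cstar_interpolation Phi (xs : seq algC) : Sdual Phi -> {in xs, forall x, x != 0} ->
  exists2 Psi, Cstar Psi & {in xs, forall x, Psi x = Phi x}.
Proof.
move=> dPhi nz; pose th := primitive_elt xs; pose n := size (conjs th).
have [P [pP unitP]] := unit_outside_seq nz.
pose E := [seq (p, t) | p <- P, t <- conjs th].
have EP j : (j < size E)%N -> (nth (0%N, 0) E j).1 \in P /\ (nth (0%N, 0) E j).2 \in conjs th.
  by move=> lt_j; have /allpairsP[[p t] /= [pin tin ->]] := mem_nth (0%N, 0) lt_j.
pose X i j := let e := nth (0%N, 0) E j in lam e.1 (aut th e.2 (nth 0 xs i)).
have nzx i : (i < size xs)%N -> nth 0 xs i != 0 by move=> lt_i; apply: nz; rewrite mem_nth.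
have Qx i : (i < size xs)%N -> Qadjoin th (nth 0 xs i).
  by move=> lt_i; apply: Qadjoin_primitive; rewrite mem_nth.
have [u uX|l lP] := @linear_solve _ (size xs) (size E) X (fun i => Phi (nth 0 xs i)).
  have [d nz_d [a aP]] := common_denominator (size xs) u.
  pose F (i : 'I_(size xs)) := nth 0 xs i ^ a i.
  have nzF i : F i != 0 by rewrite expfz_neq0 // nzx.
  have Ay : Aunit (\prod_i F i).
    apply: Aunit_lam => [|p s pr_p]; first by apply/prodf_neq0 => i _; apply: nzF.
    rewrite rmorph_prod lam_prod // => [|i _]; last by rewrite fmorph_eq0.
    transitivity (d%:~R * \sum_(i < size xs) u i * lam p (s (nth 0 xs i))).
      rewrite mulr_sumr; apply: eq_bigr => i _.
      by rewrite fmorphXz lamXz ?fmorph_eq0 ?nzx // -mulrzl aP // mulrA.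
    have [p_in|p_out] := boolP (p \in P); last first.
      by rewrite big1 ?mulr0 // => i _; rewrite (unitP p s) ?mulr0 // mem_nth.
    have : (p, s th) \in E by apply/allpairsP; exists (p, s th); rewrite p_in conjs_aut.
    move=> /[dup] pE; rewrite -index_mem => /uX; rewrite /X nth_index //= => E0.
    rewrite (_ : \sum_(i < _) _ = 0) ?mulr0 // -[RHS]E0; apply: eq_bigr => i _.
    by congr (_ * lam p _); apply: aut_eq_Qadjoin (Qx i (ltn_ord i)) _; rewrite autE ?conjs_aut.
  have := Sdual_prod (index_enum _) xpredT dPhi nzF.
  have [_ _ ->] := dPhi => // /esym sum0.
  apply: (mulfI (_ : d%:~R != 0)); first by rewrite intr_eq0.
  rewrite mulr0 -[RHS]sum0 mulr_sumr; apply: eq_bigr => i _.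
  by rewrite SdualXz ?nzx // aP // mulrA.
exists (fun x => \sum_(j < size E) (l j * n%:R) *
    atom (nth (0%N, 0) E j).1 th (nth (0%N, 0) E j).2 x).
  apply: Cstar_sum => j; apply/CstarZ/atom_Cstar.
  by apply: (allP pP); case: (EP j (ltn_ord j)).
move=> x /(nthP 0)[i lt_i <-]; rewrite -(lP i lt_i); apply: eq_bigr => j _.
have [_ tin] := EP j (ltn_ord j).
by rewrite -mulrA atom_Qadjoin //; apply: Qx.
Qed.

Theorem theorem2p3 :
  [/\ countable Cstar,
      (forall Phi, Cstar Phi -> Sprime Phi),
      Cstar (fun _ => 0),
      (forall Phi Psi, Cstar Phi -> Cstar Psi -> Cstar (fun x => Phi x + Psi x)) &
      (forall (q : rat) Phi, Cstar Phi -> Cstar (fun x => q * Phi x))] /\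
      (forall Phi, Sdual Phi -> exists Phin : nat -> algC -> rat,
         (forall n, Cstar (Phin n)) /\
         forall x, x != 0 -> exists N, forall n, (N <= n)%N -> Phin n x = Phi x).
Proof.
split; first split.
- have sub : (Cstar `<=` atom_comb @` setT)%classic.
    by move=> Phi /Cstar_atom_comb[l _ ->]; exists l.
  apply: (sub_countable (subset_card_le sub)).
  exact: (sub_countable (card_image_le _ _)).
- exact: Cstar_Sprime.
- exact: Cstar0.
- exact: CstarD.
- exact: CstarZ.
move=> Phi dPhi.
pose xs n : seq algC := [seq x <- pmap unpickle (iota 0 n) | x != 0].
have /choice[Phin PhinP] n : exists Psi, Cstar Psi /\ {in xs n, forall x, Psi x = Phi x}.
  have [|Psi CPsi PsiE] := @Cstar_interpolation Phi (xs n) dPhi; last by exists Psi.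
  by move=> x; rewrite mem_filter => /andP[].
exists Phin; split=> [n|x nz_x]; first by case: (PhinP n).
exists (pickle x).+1 => n lt_n; case: (PhinP n) => _; apply.
rewrite mem_filter nz_x mem_pmap; apply/mapP; exists (pickle x).
  by rewrite mem_iota.
by rewrite pickleK.
Qed.
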